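(* Let $H$ be a reductive (not necessarily connected) algebraic group over $\mathbf{C}$, and let $x,y$ be semisimple elements of $H$. Let $A_{x,y}=\{z\in H : zxz^{-1}y=yzxz^{-1}\}$, and let $Z^0_H(x)\times Z^0_H(y)$ act on $A_{x,y}$ by $(v,v'):z\mapsto v'zv^{-1}$. Then this action has only finitely many orbits.
   Context: For $g\in H$, $Z_H(g)=\{z\in H: zg=gz\}$ is the centralizer of $g$ in $H$ and $Z^0_H(g)$ denotes the identity component of $Z_H(g)$. *)

(* Defs.v *)
From HB Require Import structures.
From mathcomp Require Import all_boot all_order all_algebra.
From mathcomp Require Import boolp classical_sets functions cardinality reals.
From mathcomp Require Import topology complex.
From mathcomp Require mpoly.
(* The notations of mpoly clash with those of the classical library. *)
Import -(notations) mpoly.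

Set Implicit Arguments.
Unset Strict Implicit.
Unset Printing Implicit Defensive.
Import GRing.Theory.
Local Open Scope classical_set_scope.
Local Open Scope ring_scope.

(* The matrices A with p(A) = 0 for all p in S, where p is a polynomial in the
   n * n entries of A, listed in the order of mxvec. *)
Definition zeros (K : fieldType) n (S : set (mpoly (n * n) K)) :
    set 'M[K]_n :=
  [set A | forall p, S p -> meval (mxvec A 0) p = 0].

(* The affine space of n x n matrices with its Zariski topology: an alias,
   since 'M[K]_n gets the product topology when K is topological. *)
Definition zmatrix (K : fieldType) (n : nat) : Type := 'M[K]_n.

HB.instance Definition _ (K : fieldType) n :=
  Choice.copy (zmatrix K n) 'M[K]_n.

Definition zopen (K : fieldType) n (U : set (zmatrix K n)) :=
  exists S, U = ~` zeros S.

Lemma zopenT (K : fieldType) n : zopen [set: zmatrix K n].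
Proof.
exists [set 1]; apply/seteqP; split=> A // _ /(_ 1 erefl) /eqP.
by rewrite meval1 oner_eq0.
Qed.

Lemma zopenI (K : fieldType) n : setI_closed (@zopen K n).
Proof.
move=> _ _ [S ->] [T ->].
exists [set p * q | p in S & q in T]; rewrite -setCU; congr (~` _).
apply/seteqP; split=> A.
  case=> zA _ [p Sp [q Tq <-]]; rewrite mevalM.
    by rewrite zA ?mul0r.
  by rewrite (zA q) // mulr0.
move=> zA; apply: contrapT => /not_orP[/existsNP[p /not_implyP[Sp pA]]].
move=> /existsNP[q /not_implyP[Tq qA]].
have /eqP := zA _ (ex_intro2 _ _ p Sp (ex_intro2 _ _ q Tq erefl)).
by rewrite mevalM mulf_eq0 => /orP[/eqP|/eqP].
Qed.

Lemma zopen_bigU (K : fieldType) n (I : Type) (f : I -> set (zmatrix K n)) :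
  (forall i, zopen (f i)) -> zopen (\bigcup_i f i).
Proof.
move=> fo; exists [set p | exists i,
  forall A : 'M[K]_n, ~ f i A -> meval (mxvec A 0) p = 0].
apply/seteqP; split=> A.
  move=> [i _ fiA] zA; have [S fS] := fo i.
  move: (fiA); rewrite fS; apply=> p Sp.
  apply: zA; exists i => B; rewrite fS => /contrapT.
  by apply.
move=> nzA; apply: contrapT => nfA; apply: nzA => p [j]; apply=> fjA.
by apply: nfA; exists j.
Qed.

HB.instance Definition _ (K : fieldType) n :=
  isOpenTopological.Build (zmatrix K n)
    (@zopenT K n) (@zopenI K n) (@zopen_bigU K n).

Lemma zmatrix_openE (K : fieldType) n (U : set (zmatrix K n)) :
  open U <-> exists S, U = ~` zeros S.
Proof. by []. Qed.

Lemma zmatrix_closedE (K : fieldType) n (Z : set (zmatrix K n)) :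
  closed Z <-> exists S, Z = zeros S.
Proof.
rewrite -openC; split=> [[S]|[S ->]]; last by exists S.
by move=> /(congr1 setC); rewrite !setCK => ->; exists S.
Qed.

Section AlgebraicGroups.
Context {K : fieldType} {n : nat}.
Implicit Types (G H U : set (zmatrix K n)) (g x y z v w : zmatrix K n).

Definition GL : set (zmatrix K n) := [set g | g \in unitmx].

Definition is_subgroup G :=
  [/\ G `<=` GL,
      G 1%:M,
      forall g h, G g -> G h -> G (g *m h)
    & forall g, G g -> G (invmx g)].

(* A linear algebraic group is a closed subgroup of some GL_n. *)
Definition algebraic_group G :=
  is_subgroup G /\ exists2 Z : set (zmatrix K n), closed Z & G = GL `&` Z.

Definition identity_component G : set (zmatrix K n) :=
  connected_component G 1%:M.

Definition centralizer H g : set (zmatrix K n) :=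
  [set z | H z /\ z *m g = g *m z].

(* This is semisimplicity only over an algebraically closed K, such as R[i]. *)
Definition semisimple g := diagonalizable g.

Definition unipotent g := exists k, (g - 1%:M : 'M[K]_n) ^+ k = 0.

Definition normal_in U H :=
  U `<=` H /\ forall h u, H h -> U u -> U (h *m u *m invmx h).

(* The largest closed connected normal unipotent subgroup of H, as the union
   of all of them. *)
Definition unipotent_radical H : set (zmatrix K n) :=
  \bigcup_(U in [set U | [/\ algebraic_group U, connected U, normal_in U H
                           & forall u, U u -> unipotent u]]) U.

Definition reductive H :=
  algebraic_group H /\ unipotent_radical H = [set 1%:M].

Definition commuting_transporter H x y : set (zmatrix K n) :=
  [set z | H z /\ z *m x *m invmx z *m y = y *m (z *m x *m invmx z)].

Definition transporter_orbit H x y z : set (zmatrix K n) :=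
  [set w | exists v v', [/\ identity_component (centralizer H x) v,
     identity_component (centralizer H y) v' & w = v' *m z *m invmx v]].

Lemma identity_component_sub G : identity_component G `<=` G.
Proof. exact: connected_component_sub. Qed.

Lemma centralizer_subgroup H g :
  is_subgroup H -> is_subgroup (centralizer H g).
Proof.
case=> HGL H1 HM HV; split.
- by move=> z [/HGL].
- by split=> //; rewrite mul1mx mulmx1.
- move=> z w [Hz zg] [Hw wg]; split; first exact: HM.
  by rewrite -mulmxA wg mulmxA zg mulmxA.
- move=> z [Hz zg]; split; first exact: HV.
  have uz : z \in unitmx by exact: HGL.
  by rewrite -[RHS](mulKmx uz) (mulmxA z) zg mulmxK.
Qed.

Lemma continuous_mull g : continuous (fun z => g *m z : zmatrix K n).
Proof.
apply/continuousP => U /zmatrix_openE[S ->]; apply/zmatrix_openE.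
pose ent (k : 'I_(n * n)) : mpoly (n * n) K :=
  \sum_j mpolyC _ ((lin_mulmx g : 'M_(n * n)) j k) * mpolyX K (mnm1 j).
exists [set comp_mpoly [tuple ent k | k < n * n] p | p in S].
have entE A p : meval (mxvec A 0) (comp_mpoly [tuple ent k | k < n * n] p)
    = meval (mxvec (g *m A) 0) p.
  rewrite comp_mpoly_meval; apply: meval_eq => k.
  rewrite tnth_mktuple raddf_sum /= -mul_vec_lin mxE; apply: eq_bigr => j _.
  by rewrite mevalM mevalC mevalXU mulrC.
apply/seteqP; split=> A /= nzA zA; apply: nzA.
  by move=> p Sp; rewrite -entE; apply: zA; exists p.
by move=> _ [p Sp <-]; rewrite entE; apply: zA.
Qed.

Lemma identity_component_mull G g z : is_subgroup G ->
  identity_component G g -> identity_component G z ->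
  identity_component G (g *m z).
Proof.
move=> [_ G1 GM _] Gg Gz; set G0 := identity_component G.
have G0c : connected G0 by exact: component_connected.
have G01 : G0 1%:M by exact: connected_component_refl.
pose gG0 : set (zmatrix K n) := [set (g *m w : zmatrix K n) | w in G0].
have gG0c : connected gG0.
  apply: connected_continuous_connected => //.
  exact/continuous_subspaceT/continuous_mull.
have gg : gG0 g by exists 1%:M => //; rewrite mulmx1.
apply: (@connected_component_max _ G (G0 `|` gG0)); first by left.
- move=> w [/identity_component_sub//|[u /identity_component_sub Gu <-]].
  by apply: GM => //; exact: identity_component_sub.
- by apply: connectedU => //; exists g.
- by right; exists z.
Qed.

Lemma identity_component_subgroup G :
  is_subgroup G -> is_subgroup (identity_component G).
Proof.
move=> gG; have [GGL G1 GM GV] := gG.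
have sub := @identity_component_sub G.
split=> [||g h|g Gg]; first by move=> z /sub/GGL.
- exact: connected_component_refl.
- exact: identity_component_mull.
have ug : g \in unitmx by apply/GGL/sub.
pose gG0 : set (zmatrix K n) :=
  [set (invmx g *m w : zmatrix K n) | w in identity_component G].
apply: (@connected_component_max _ G gG0).
- by exists g => //; rewrite mulVmx.
- by move=> _ [w /sub Gw <-]; apply: GM => //; apply: GV; apply: sub.
- apply: connected_continuous_connected; first exact: component_connected.
  exact/continuous_subspaceT/continuous_mull.
- by exists 1%:M; [exact: connected_component_refl|rewrite mulmx1].
Qed.

Lemma transporter_orbit_sub H x y z : is_subgroup H ->
  commuting_transporter H x y z ->
  transporter_orbit H x y z `<=` commuting_transporter H x y.
Proof.
move=> gH [Hz zxy] _ [v [v' [/identity_component_sub [Hv vx]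
  /identity_component_sub [Hv' v'y] ->]]].
have [HGL _ HM HV] := gH.
have [uz uv uv'] : [/\ z \in unitmx, v \in unitmx & v' \in unitmx].
  by split; exact: HGL.
have conjM : v' *m z *m invmx v *m x *m invmx (v' *m z *m invmx v)
    = v' *m (z *m x *m invmx z) *m invmx v'.
  have [_ vxV] : centralizer H x (invmx v).
    by have [_ _ _] := centralizer_subgroup x gH; apply.
  have Vmul (a b : 'M[K]_n) : a \in unitmx -> b \in unitmx ->
      invmx (a *m b) = invmx b *m invmx a.
    move=> ua ub; apply: (can_inj (mulKmx (_ : a *m b \in unitmx))).
      by rewrite unitmx_mul ua.
    rewrite mulmxV ?unitmx_mul ?ua // -mulmxA (mulmxA b) mulmxV // mul1mx.
    by rewrite mulmxV.
  rewrite !Vmul ?unitmx_mul ?unitmx_inv ?uv' ?uz // invmxK -!mulmxA.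
  by rewrite (mulmxA (invmx v)) vxV -!mulmxA (mulmxA (invmx v) v) mulVmx //
    mul1mx.
have [_ v'yV] : centralizer H y (invmx v').
  by have [_ _ _] := centralizer_subgroup y gH; apply.
split; first by apply: (HM (v' *m z)); [exact: HM|exact: HV].
rewrite conjM -!mulmxA v'yV [RHS]mulmxA -v'y -[RHS]mulmxA; congr (_ *m _).
by rewrite -!mulmxA !mulmxA in zxy *; rewrite zxy.
Qed.

End AlgebraicGroups.

(* Main.v *)
Require Import Defs.
From mathcomp Require Import all_boot all_order all_algebra.
From mathcomp Require Import boolp classical_sets functions cardinality reals.
From mathcomp Require Import topology complex.
From mathcomp Require Import constructive_ereal lebesgue_measure.
From mathcomp Require Import ring closed_field.
From mathcomp Require mpoly.
Import -(notations) mpoly.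

(** The transporter A = commuting_transporter H x y is closed in GL_n, and the product
    G of the centralizers of y and x in H acts on it by z |-> g z h. There are finitely
    many orbits because each of them is open in A. Infinitesimally this is the
    following computation ([transporter_tangent]). Let v z be a tangent vector to A at
    z, with v in the Lie algebra of H, and let x' = z x z^-1. Since x' stays in the
    centralizer of y, the bracket [v, x'] commutes with y. As y is semisimple, v is the
    sum of a part that commutes with y and of a part in the other eigenspaces of Ad y,
    both in the Lie algebra of H. The bracket of the latter part with x' has to be 0, so
    that v z is the sum of vectors tangent to the orbits of the centralizers of y and of
    x. That the Lie algebra of these centralizers is as expected is [lie_centralizer],
    where characteristic 0 enters.

    Instead of comparing dimensions, the proof goes from tangent vectors to orbits by
    means of derivations D of the field K. If D kills the coefficients of the
    equations of H, x and y, and z is any point of A, then Dz is a tangent vector to A,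
    so it is tangent to the orbit of z. Deriving the equation f(w) = 0 for w in the
    orbit shows that D preserves the ideal of the orbit
    ([full_orbit_vanishing_stable]). By linear algebra this ideal is then spanned by
    polynomials whose coefficients are killed by all these D
    ([derivation_stable_ind]); such constants are algebraic over the coefficients of
    the equations, and so they form a countable field ([countable_constants]). Hence
    the closure of every orbit is defined over one countable field.

    As K is uncountable, an irreducible closed set B has a point z outside all the
    closed proper subsets of B defined over a given countable field
    ([countable_nullstellensatz]). If B is contained in the closure of A, it follows
    that the orbit of z is dense in B. An orbit is open in its closure
    ([full_orbit_locally_closed], from quantifier elimination over K), so that all of B
    but a closed proper subset is in the orbit of z. Noetherian induction gives that
    there are finitely many orbits of G ([finite_full_orbits]). The identity components
    of the centralizers have finite index ([identity_component_finite_index]), which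
    gives the theorem for them. *)

Set Implicit Arguments.
Unset Strict Implicit.
Unset Printing Implicit Defensive.
Import Order.TTheory GRing.Theory Num.Theory.
Local Open Scope classical_set_scope.
Local Open Scope ring_scope.

(** * Ideals of polynomials *)

Inductive ideal_gen (A : comNzRingType) (S : set A) : A -> Prop :=
| ideal_gen0 : ideal_gen S 0
| ideal_genMD q p r : S p -> ideal_gen S r -> ideal_gen S (q * p + r).

Section Ideals.
Variables (A : comNzRingType).
Implicit Types (S T : set A) (p q r : A).

Lemma ideal_gen_mem S p : S p -> ideal_gen S p.
Proof.
by move=> Sp; rewrite -[p]mul1r -[_ * _]addr0; apply/ideal_genMD/ideal_gen0.
Qed.

Lemma ideal_genD S p q : ideal_gen S p -> ideal_gen S q -> ideal_gen S (p + q).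
Proof.
move=> Ip Iq; elim: Ip => [|a b c Sb _ IH]; first by rewrite add0r.
by rewrite -addrA; apply: ideal_genMD.
Qed.

Lemma ideal_genMl S q p : ideal_gen S p -> ideal_gen S (q * p).
Proof.
elim=> [|a b c Sb _ IH]; first by rewrite mulr0; apply: ideal_gen0.
by rewrite mulrDr mulrA; apply: ideal_genMD.
Qed.

Lemma ideal_genB S p q : ideal_gen S p -> ideal_gen S q -> ideal_gen S (p - q).
Proof.
by move=> Ip Iq; rewrite -mulN1r; apply: ideal_genD => //; apply: ideal_genMl.
Qed.

Lemma ideal_gen_sub S T : S `<=` ideal_gen T -> ideal_gen S `<=` ideal_gen T.
Proof.
move=> ST p; elim=> [|q {}p r Sp _ IH]; first exact: ideal_gen0.
by apply: ideal_genD => //; apply/ideal_genMl/ST.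
Qed.

Lemma ideal_gen_sum S (I : Type) (s : seq I) (F : I -> A) :
  (forall i, ideal_gen S (F i)) -> ideal_gen S (\sum_(i <- s) F i).
Proof.
move=> SF; elim/big_ind: _ => // [|? ? ? ?]; first exact: ideal_gen0.
exact: ideal_genD.
Qed.

Lemma ideal_gen_fin S p : ideal_gen S p ->
  exists2 s : seq A, [set` s] `<=` S & ideal_gen [set` s] p.
Proof.
elim=> [|q {}p r Sp _ [s sS sr]]; first by exists [::] => //; exact: ideal_gen0.
exists (p :: s).
  by move=> a /=; rewrite inE => /predU1P[->//|/sS].
apply: ideal_genMD; first by rewrite /= mem_head.
by apply: ideal_gen_sub sr => a /= sa; apply: ideal_gen_mem; rewrite /= inE sa orbT.
Qed.

End Ideals.

(** Each term is taken minimal among those that come after the previous one. *)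
Lemma nondecreasing_subseq (u : nat -> nat) :
  exists2 phi : nat -> nat, {homo phi : i j / (i < j)%N} &
    {homo u \o phi : i j / (i <= j)%N}.
Proof.
have /choice[f fP] N : exists i, (N <= i)%N /\ forall j, (N <= j)%N -> (u i <= u j)%N.
  have exm : exists m, `[<exists2 i, (N <= i)%N & u i = m>].
    by exists (u N); apply/asboolP; exists N.
  case: (ex_minnP exm) => _ /asboolP[i Ni <-] min; exists i; split=> // j Nj.
  by apply: min; apply/asboolP; exists j.
pose phi k := iter k (fun i => f i.+1) (f 0).
have phiS k : (phi k < phi k.+1)%N by have [] := fP (phi k).+1.
have phi_homo : {homo phi : i j / (i < j)%N} by apply: homo_ltn => //; exact: ltn_trans.
exists phi => //; apply: homo_leq => // [k l m|i]; first exact: leq_trans.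
case: i => [|i] /=; first by have [_] := fP 0; apply.
have [_] := fP (phi i).+1; apply; exact: ltn_trans (phiS i) (phiS i.+1).
Qed.

(** Extract a subsequence that is nondecreasing in one coordinate after the other. *)
Lemma dickson n (u : nat -> multinom n) :
  exists i j, (i < j)%N /\ lem (u i) (u j).
Proof.
have [phi phi_lt phi_le] : exists2 phi : nat -> nat,
    {homo phi : i j / (i < j)%N} &
    forall k : 'I_n, k \in enum 'I_n ->
      forall i j, (i <= j)%N -> (u (phi i) k <= u (phi j) k)%N.
  elim: (enum 'I_n) => [|k s [phi phi_lt phi_le]]; first by exists id.
  have [psi psi_lt psi_le] := nondecreasing_subseq (fun i => u (phi i) k).
  exists (phi \o psi) => [i j ij|l]; first exact/phi_lt/psi_lt.
  rewrite inE => /predU1P[-> i j /psi_le//|ls i j ij].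
  by apply: phi_le => //; case: ltngtP ij => // [/psi_lt/ltnW//|->].
exists (phi 0), (phi 1); split; first exact: phi_lt.
by apply/mnm_lepP => k; apply: phi_le; rewrite ?mem_enum.
Qed.

Section Hilbert.
Variables (K : fieldType) (n : nat).
Implicit Types (S : set (mpoly n K)) (p q : mpoly n K).

(** Otherwise one could go on for ever choosing elements whose leading monomial is
    a multiple of none of the previous ones, against Dickson's lemma. *)
Lemma mlead_basis S : exists s : seq (mpoly n K), [set` s] `<=` S /\
  forall p, S p -> p != 0 -> exists q, [/\ q \in s, q != 0 & lem (mlead q) (mlead p)].
Proof.
apply: contrapT => /forallNP noS.
have /choice[f fP] (s : seq (mpoly n K)) : exists p, [set` s] `<=` S ->
    [/\ S p, p != 0 & forall q, q \in s -> q != 0 -> ~ lem (mlead q) (mlead p)].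
  have [sS|nsS] := pselect ([set` s] `<=` S); last by exists 0.
  apply: contrapT => /forallNP nop; apply: (noS s); split=> // p Sp p0.
  apply: contrapT => /forallNP noq; apply: (nop p) => _; split=> // q qs q0 qp.
  exact: (noq q).
pose s := fix s i := if i is j.+1 then f (s j) :: s j else [::].
have sS i : [set` s i] `<=` S.
  elim: i => [//|i IH] q /=; rewrite inE => /predU1P[->|/IH//].
  by have [] := fP _ IH.
have s_mem i j : (i < j)%N -> f (s i) \in s j.
  elim: j => // j IH; rewrite ltnS leq_eqVlt inE => /predU1P[->|/IH->].
    by rewrite eqxx.
  by rewrite orbT.
have [i [j [ij le_ij]]] := dickson (fun i => mlead (f (s i))).
have [_ _ /(_ _ (s_mem _ _ ij))] := fP _ (sS j).
by have [_ fi0 _] := fP _ (sS i) => /(_ fi0).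
Qed.

(** The finite set of [mlead_basis] for the whole ideal generates it, because
    subtracting a multiple of one of its elements lowers the leading monomial.
    Each of its elements involves finitely many elements of S. *)
Theorem hilbert_basis S : exists s : seq (mpoly n K),
  [set` s] `<=` S /\ S `<=` ideal_gen [set` s].
Proof.
have [s [sS s_lead]] := mlead_basis (ideal_gen S).
have Is p : ideal_gen S p -> ideal_gen [set` s] p.
  elim/mleadrect: p => p IH Ip; have [->|p0] := eqVneq p 0; first exact: ideal_gen0.
  have [q [qs q0 qp]] := s_lead p Ip p0.
  set c := mcoeff (mlead p) p / mcoeff (mlead q) q.
  set t := c *: mpolyX K (mnm_sub (mlead p) (mlead q)).
  have Ir : ideal_gen S (p - t * q) by apply: ideal_genB => //; apply/ideal_genMl/sS.
  have c0 : c != 0 by rewrite mulf_neq0 ?invr_eq0 ?mleadc_eq0.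
  have lead_tq : mlead (t * q) = mlead p.
    rewrite mleadM //; last first.
      by rewrite -msize_poly_eq0 msizeZ // msizeX.
    by rewrite mleadZ // mleadXm submK.
  have leadc_tq : mcoeff (mlead p) (t * q) = mcoeff (mlead p) p.
    rewrite -scalerAl mcoeffZ (mulrC _ q) -{1}(submK qp) mcoeffMX.
    by rewrite divfK ?mleadc_eq0.
  rewrite -(subrK (t * q) p); apply: ideal_genD; last exact/ideal_genMl/ideal_gen_mem.
  have [->|r0] := eqVneq (p - t * q) 0; first exact: ideal_gen0.
  apply: IH => //; have := mleadB_le p (t * q); rewrite lead_tq joinxx.
  rewrite le_eqVlt => /predU1P[le|//]; move: r0.
  by rewrite -mleadc_eq0 le mcoeffB leadc_tq subrr eqxx.
have [t [tS st]] : exists t : seq (mpoly n K), [set` t] `<=` S /\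
    [set` s] `<=` ideal_gen [set` t].
  elim: s sS {s_lead Is} => [_|p s IH sS]; first by exists [::].
  have [|t [tS st]] := IH; first by move=> q qs; apply: sS; rewrite /= inE qs orbT.
  have [|u uS up] := @ideal_gen_fin _ S p; first by apply: sS; rewrite /= mem_head.
  exists (u ++ t); split=> q /=; first by rewrite mem_cat => /orP[/uS|/tS].
  rewrite inE => /predU1P[->|/st qt].
    by apply: ideal_gen_sub up => r /= ru; apply: ideal_gen_mem; rewrite /= mem_cat ru.
  by apply: ideal_gen_sub qt => r /= rt; apply: ideal_gen_mem; rewrite /= mem_cat rt orbT.
exists t; split=> // p Sp; apply: ideal_gen_sub st _ _.
exact/Is/ideal_gen_mem.
Qed.

End Hilbert.

(** * Points of closed sets over an uncountable field *)

Lemma mpoly_alg_ind (K : comNzRingType) n (P : mpoly n K -> Prop) :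
    (forall c, P (mpolyC n c)) -> (forall i, P (mpolyX K (mnm1 i))) ->
    (forall p q, P p -> P q -> P (p + q)) ->
    (forall p q, P p -> P q -> P (p * q)) ->
  forall p, P p.
Proof.
move=> PC PX PD PM p.
have P0 : P 0 by rewrite -(mpolyC0 n).
have P1 : P 1 by rewrite -mpolyC1.
rewrite (mpolyE p); apply: (big_ind P P0 PD) => m _.
rewrite -mul_mpolyC; apply: (PM) => //; rewrite mpolyXE_id.
apply: (big_ind P P1 PM) => i _; elim: (m i) => [|k IH]; first by rewrite expr0.
by rewrite exprS; apply: PM.
Qed.

Lemma infinite_fiber (T U : Type) (f : T -> U) :
  ~ countable [set: T] -> countable (range f) ->
  exists u, infinite_set (f @^-1` [set u]).
Proof.
move=> uT cf; apply: contrapT => /forallNP fin; apply: uT.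
have -> : [set: T] = \bigcup_(u in range f) (f @^-1` [set u]).
  by apply/seteqP; split=> // t _; exists (f t).
by apply: bigcup_countable => // u _; apply: finite_set_countable; apply: contrapT.
Qed.

Lemma infinite_tuple (T : choiceType) (A : set T) m : infinite_set A ->
  exists2 a : 'I_m -> T, injective a & forall i, A (a i).
Proof.
move=> /infiniteP /card_leP[f].
exists (fun i : 'I_m => val (f (to_setT (i : nat)))) => [i j /= ij|i].
  have := inj (in_setT _) (in_setT _) (val_inj ij).
  by move=> /(congr1 sval) /= /val_inj.
by rewrite -in_setE; apply: valP.
Qed.

(** Polynomials of bounded degree have finitely many coefficients. *)
Lemma mpoly_dependent (K : fieldType) n d (I : finType) (q : I -> mpoly n K) :
    (forall i, (mmeasure mdeg (q i) <= d)%N) -> (#|{: bmultinom n d}| < #|I|)%N ->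
  exists2 c : I -> K, (exists i, c i != 0) & \sum_i c i *: q i = 0.
Proof.
move=> qd cardI.
pose M : 'M[K]_(#|I|, #|{: bmultinom n d}|) :=
  \matrix_(i, k) mcoeff (bmnm (enum_val k)) (q (enum_val i)).
have /rowV0Pn[v vM v0] : kermx M != 0.
  rewrite kermx_eq0 -row_leq_rank -ltnNge.
  exact: leq_ltn_trans (rank_leq_col _) _.
exists (fun i => v 0 (enum_rank i)).
  by have /rV0Pn[i vi] := v0; exists (enum_val i); rewrite enum_valK.
apply/mpolyP => m; rewrite mcoeff0 raddf_sum /=.
have [md|md] := ltnP (mdeg m) d; last first.
  rewrite big1 // => i _; rewrite mcoeffZ memN_msupp_eq0 ?mulr0 //.
  by apply: msize_mdeg_ge; apply: leq_trans md.
move/sub_kermxP: vM => /rowP /(_ (enum_rank (BMultinom md))).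
rewrite !mxE => vM; rewrite -[RHS]vM (reindex_onto enum_val enum_rank) /=; last first.
  by move=> i _; rewrite enum_rankK.
apply: eq_big => [i|i _]; first by rewrite enum_valK eqxx.
by rewrite mcoeffZ !mxE !enum_valK enum_rankK.
Qed.

Section Nullstellensatz.
Variables (K : closedFieldType) (n : nat).
Hypothesis uncountableK : ~ countable [set: K].
Implicit Types (J S I : set (mpoly n K)) (p q r : mpoly n K).

(** The last clause is maximality: S meets the ideal generated by I and p. *)
Lemma maximal_avoiding_ideal J S : (forall p, S p -> ~ ideal_gen J p) ->
  exists I, [/\ I = ideal_gen I, J `<=` I, forall p, S p -> ~ I p
    & forall p, ~ I p -> exists q, exists2 s, S s & I (s - q * p)].
Proof.
move=> JS; pose P A := forall p, S p -> ~ ideal_gen (J `|` A) p.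
have [|A [PA maxA]] := @Zorn_bigcup _ P.
  move=> F FP Ftot p Sp /ideal_gen_fin[s sF sp].
  have [F0|/set0P[X0 FX0]] := eqVneq F set0.
    apply: (JS p) => //; apply: ideal_gen_sub sp => q /sF[|[X]].
      exact: ideal_gen_mem.
    by rewrite F0.
  suff [X FX sX] : exists2 X, F X & [set` s] `<=` J `|` X.
    have PX : P X := FP X FX.
    by apply: (PX p Sp); apply: ideal_gen_sub sp => q /sX; apply: ideal_gen_mem.
  elim: s sF {sp} => [|q s IH] sF; first by exists X0.
  have [|X FX sX] := IH; first by move=> r rs; apply: sF; rewrite /= inE rs orbT.
  have [|Jq|[Y FY Yq]] := sF q; first by rewrite /= mem_head.
    by exists X => // r /=; rewrite inE => /predU1P[->|/sX]; [left|].
  have [XY|YX] := Ftot X Y FX FY.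
    exists Y => // r /=; rewrite inE => /predU1P[->|/sX]; first by right.
    by case=> [|/XY]; [left|right].
  exists X => // r /=; rewrite inE => /predU1P[->|/sX//].
  by right; apply: YX.
exists (ideal_gen (J `|` A)); split=> //.
- apply/seteqP; split=> p; first exact: ideal_gen_mem.
  exact: (@ideal_gen_sub _ _ _ (fun p => id)).
- by move=> p Jp; apply: ideal_gen_mem; left.
move=> p Ip.
have /existsNP[s /not_implyP[Ss /contrapT Is]] : ~ P (A `|` [set p]).
  apply: maxA; split; first by left.
  by move=> pA; apply: Ip; apply: ideal_gen_mem; right; apply: pA; right.
suff [q Iq] : exists q, ideal_gen (J `|` A) (s - q * p) by exists q, s.
elim: {Ss} Is => [|a b c bJ _ [q Iq]].
  by exists 0; rewrite mul0r subr0; apply: ideal_gen0.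
have [bA|bA] : (J `|` A) b \/ b = p by move: bJ => [|[]]; [left; left|left; right|right].
  by exists q; rewrite -addrA; apply: ideal_genMD.
by exists (a + q); rewrite bA mulrDl opprD addrACA subrr add0r.
Qed.

(** An ideal I maximal among those that contain J and avoid S is prime; it is shown to
    be the ideal of a point, by finding each coordinate as some b with X_j - b in I.
    If there were none, each X_j - a would divide an element of S modulo I, with a
    cofactor q a. Since K is uncountable while S and the degrees are countable, there
    are infinitely many a for which this element is the same and q a has the same
    degree, hence a linear relation between some of the q a. Clearing denominators in
    this relation between multiples of the 1 / (X_j - a) gives a nonzero polynomial
    g(X_j) in I, and one of the linear factors of g is in I. *)
Theorem countable_nullstellensatz J S :
    countable S -> S 1 -> (forall p q, S p -> S q -> S (p * q)) ->
    (forall p, S p -> ~ ideal_gen J p) ->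
  exists b : 'I_n -> K,
    (forall p, J p -> meval b p = 0) /\ (forall p, S p -> meval b p <> 0).
Proof.
move=> cS S1 SM /maximal_avoiding_ideal[I [IE JI IS Imax]].
have ID p q : I p -> I q -> I (p + q) by rewrite IE; apply: ideal_genD.
have IMl q p : I p -> I (q * p) by rewrite IE; apply: ideal_genMl.
have IB p q : I p -> I q -> I (p - q) by rewrite IE; apply: ideal_genB.
have Isum (T : Type) (s : seq T) F : (forall i, I (F i)) -> I (\sum_(i <- s) F i).
  by rewrite IE; apply: ideal_gen_sum.
have Iprime p q : I (p * q) -> I p \/ I q.
  move=> Ipq; apply: contrapT => /not_orP[/Imax[a [s Ss Is]] /Imax[b [t St It]]].
  apply: (IS (s * t)); first exact: SM.
  have -> : s * t = t * (s - a * p) + (a * p) * (t - b * q) + (a * b) * (p * q).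
    by rewrite !mulrBr [a * p * (b * q)]mulrACA (mulrC t s) (mulrC t) addrA addrNK addrNK.
  by apply: (ID); [apply: (ID)|]; apply: IMl.
have Iconst c : I (mpolyC n c) -> c = 0.
  move=> Ic; apply: contrapT => /eqP c0; apply: (IS 1) => //.
  by rewrite -mpolyC1 -(mulVf c0) mpolyCM; apply: IMl.
have linear_root j : exists b, I (mpolyX K (mnm1 j) - mpolyC n b).
  apply: contrapT => /forallNP noroot; pose X a := mpolyX K (mnm1 j) - mpolyC n a.
  have /choice[q /choice[s qsP]] a : exists q s, S s /\ I (s - q * X a).
    by have [q [s Ss]] := Imax _ (noroot a); exists q, s.
  have [|[t d] inf] :=
      @infinite_fiber _ _ (fun a => (s a, mmeasure mdeg (q a))) uncountableK.
    apply: (@sub_countable _ _ _ (S `*` [set: nat])); last exact: countableX.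
    by apply: subset_card_le => _ [a _ <-]; split=> //=; have [] := qsP a.
  set m := #|{: bmultinom n d}|.
  have [a a_inj afib] := infinite_tuple m.+1 inf.
  have sa i : s (a i) = t by have [] := afib i.
  have qa i : mmeasure mdeg (q (a i)) = d by have [] := afib i.
  have [|| c [i0 c0] cq] := @mpoly_dependent K n d _ (fun i => q (a i)).
  - by move=> i; rewrite qa.
  - by rewrite card_ord.
  pose g : {poly K} := \sum_i c i *: \prod_(k | k != i) ('X - (a k)%:P).
  pose ev : {poly K} -> mpoly n K := horner_alg (mpolyX K (mnm1 j)).
  have evX b : ev ('X - b%:P) = X b.
    by rewrite /ev rmorphB /= horner_algX horner_algC alg_mpolyC.
  have evZ c' (u : {poly K}) : ev (c' *: u) = c' *: ev u.
    by rewrite -mul_polyC /ev rmorphM /= horner_algC alg_mpolyC mul_mpolyC.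
  have ev_sum (I' : finType) F : ev (\sum_(i : I') F i) = \sum_i ev (F i).
    exact: raddf_sum.
  have ev_prod (I' : finType) (Q : pred I') F :
      ev (\prod_(i | Q i) F i) = \prod_(i | Q i) ev (F i) by exact: rmorph_prod.
  have g0 : g != 0.
    apply/negP => /eqP /(congr1 (horner^~ (a i0))); rewrite horner0 horner_sum.
    rewrite (bigD1 i0) //= [X in _ + X]big1 ?addr0 => [|i i0i]; last first.
      rewrite hornerZ (bigD1 i0) 1?eq_sym //= hornerM hornerXsubC subrr.
      by rewrite mul0r mulr0.
    rewrite hornerZ horner_prod; apply/eqP; rewrite mulf_neq0 //.
    apply/prodf_neq0 => k ki0; rewrite hornerXsubC subr_eq0.
    by apply: contraNneq ki0 => /a_inj ->.
  have Itg : I (t * ev g).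
    have -> : t * ev g = \sum_i (c i *: ev (\prod_(k | k != i) ('X - (a k)%:P)))
         * (s (a i) - q (a i) * X (a i)).
      have cqX : \sum_i (c i *: q (a i)) * (\prod_k X (a k)) = 0.
        by rewrite -mulr_suml cq mul0r.
      rewrite -[LHS]subr0 -[X in _ - X]cqX /g ev_sum.
      rewrite mulr_sumr -sumrB; apply: eq_bigr => i _.
      rewrite sa evZ [\prod_k X (a k)](bigD1 i) //=.
      have -> : \prod_(k | k != i) X (a k) = ev (\prod_(k | k != i) ('X - (a k)%:P)).
        by rewrite ev_prod; apply: eq_bigr => k _; rewrite -evX.
      by rewrite -!mul_mpolyC; ring.
    by apply: Isum => i; apply: IMl; have [] := qsP (a i).
  have {Itg} Ig : I (ev g).
    by case: (Iprime _ _ Itg) => // /IS[]; rewrite -(sa i0); have [] := qsP (a i0).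
  have [rs grs] := closed_field_poly_normal g.
  have {Ig} : I (ev (\prod_(z <- rs) ('X - z%:P))).
    move: Ig; rewrite {1}grs evZ -mul_mpolyC => /Iprime[/Iconst|//].
    by move/eqP; rewrite lead_coef_eq0 (negPf g0).
  elim: (rs) => [|r l IH].
    by rewrite big_nil /ev rmorph1 -mpolyC1 => /Iconst/eqP; rewrite oner_eq0.
  by rewrite big_cons /ev rmorphM /= -/ev evX => /Iprime[/noroot|/IH].
have /choice[b bP] := linear_root.
have Ib p : I (p - mpolyC n (meval b p)).
  elim/mpoly_alg_ind: p => [c|i|p q Ip Iq|p q Ip Iq].
  - by rewrite mevalC subrr IE; apply: ideal_gen0.
  - by rewrite mevalXU.
  - by rewrite mevalD mpolyCD opprD addrACA; apply: ID.
  rewrite mevalM mpolyCM.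
  have -> : p * q - mpolyC n (meval b p) * mpolyC n (meval b q) =
      q * (p - mpolyC n (meval b p)) + mpolyC n (meval b p) * (q - mpolyC n (meval b q)).
    by rewrite !mulrBr (mulrC q) [q * _]mulrC addrA addrNK.
  by apply: ID; apply: IMl.
exists b; split=> p => [/JI|] Hp.
  by apply: Iconst; rewrite -[X in I X](subKr p); apply: IB.
by move=> pb; apply: (IS p) => //; have := Ib p; rewrite pb mpolyC0 subr0.
Qed.

End Nullstellensatz.

(** * Derivations of a field and their constants *)

Definition derivation (K : fieldType) (D : K -> K) :=
  {morph D : x y / x + y} /\ forall x y, D (x * y) = D x * y + x * D y.

Section DerivationTheory.
Variables (K : fieldType) (D : K -> K).
Hypothesis derD : derivation D.

Lemma derivationD : {morph D : x y / x + y}. Proof. by case: derD. Qed.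

Lemma derivationM x y : D (x * y) = D x * y + x * D y.
Proof. by case: derD. Qed.

Lemma derivation0 : D 0 = 0.
Proof. by apply: (addrI (D 0)); rewrite -derivationD !addr0. Qed.

Lemma derivation1 : D 1 = 0.
Proof.
by apply: (addrI (D 1)); rewrite addr0 -[in RHS](mul1r 1) derivationM mulr1 mul1r.
Qed.

Lemma derivation_sum (I : Type) (s : seq I) (F : I -> K) :
  D (\sum_(i <- s) F i) = \sum_(i <- s) D (F i).
Proof. by rewrite (big_morph D derivationD derivation0). Qed.

End DerivationTheory.

(** The non-unital subring of the dual numbers K + eps K that is generated by a set of
    elements u + eps v. Such subrings stand for partially defined derivations: the
    graph of a derivation on a subring of K is a subring of the dual numbers that
    meets eps K only in 0. *)
Inductive dual_gen (K : fieldType) (B : K -> K -> Prop) : K -> K -> Prop :=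
| dual_mem u v : B u v -> dual_gen B u v
| dual_sub u v u' v' : dual_gen B u v -> dual_gen B u' v' ->
    dual_gen B (u - u') (v - v')
| dual_mul u v u' v' : dual_gen B u v -> dual_gen B u' v' ->
    dual_gen B (u * u') (v * u' + u * v').

Lemma dual_gen_sub (K : fieldType) (B B' : K -> K -> Prop) u v :
  (forall u v, B u v -> B' u v) -> dual_gen B u v -> dual_gen B' u v.
Proof.
move=> BB'; elim=> {u v} [u v /BB'|u v u' v' _ Bu _ Bu'|u v u' v' _ Bu _ Bu'].
- exact: dual_mem.
- exact: dual_sub.
- exact: dual_mul.
Qed.

Section DualGraph.
Variables (K : numFieldType) (G : K -> K -> Prop).
Hypothesis G0 : G 0 0.
Hypothesis G1 : G 1 0.
Hypothesis GB : forall u v u' v', G u v -> G u' v' -> G (u - u') (v - v').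
Hypothesis GM : forall u v u' v', G u v -> G u' v' ->
  G (u * u') (v * u' + u * v').
Hypothesis Gfun : forall v, G 0 v -> v = 0.
Implicit Types p q : {poly K}.

Let GD u v u' v' : G u v -> G u' v' -> G (u + u') (v + v').
Proof.
move=> Gu Gu'; rewrite -[u']opprK -[v']opprK; apply: (GB) => //.
by rewrite -(sub0r u') -(sub0r v'); apply: GB.
Qed.

Let poly_graph p q := forall i, G p`_i q`_i.

Let poly_graph0 q : poly_graph 0 q -> q = 0.
Proof.
move=> Gq; apply/polyP => i; rewrite coef0; apply: Gfun.
by have := Gq i; rewrite coef0.
Qed.

Let poly_graphB p q p' q' :
  poly_graph p q -> poly_graph p' q' -> poly_graph (p - p') (q - q').
Proof. by move=> Gp Gp' i; rewrite !coefB; apply: GB. Qed.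

Let poly_graphM p q p' q' :
  poly_graph p q -> poly_graph p' q' -> poly_graph (p * p') (q * p' + p * q').
Proof.
move=> Gp Gp' i; rewrite coefD !coefM -big_split /=.
apply: (big_ind2 G G0) => [u v u' v'|j _]; [exact: GD|exact: GM].
Qed.

Let poly_graphXn u v d : G u v -> poly_graph (u%:P * 'X^d) (v%:P * 'X^d).
Proof.
by move=> Guv i; rewrite !coefCM !coefXn; case: eqP => _; rewrite ?mulr1 ?mulr0.
Qed.

Let poly_graph_deriv p q : poly_graph p q -> poly_graph p^`() q^`().
Proof.
move=> Gp i; rewrite !coef_deriv; have GMn u v k : G u v -> G (u *+ k) (v *+ k).
  by move=> Guv; elim: k => // k IH; rewrite !mulrS; apply: GD.
exact: GMn.
Qed.

(** What the value c of a derivation at b has to satisfy. If b is a root of some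
    p0 <> 0 over the domain, of least degree, then its equation determines c because
    b is not a root of the derivative of p0, in characteristic 0. Pseudo-division by
    p0 carries the equation over to all the other polynomials. *)
Lemma dual_graph_extend b : exists c, forall p q,
  poly_graph p q -> p.[b] = 0 -> q.[b] + c * p^`().[b] = 0.
Proof.
have [alg_b|trans_b] := pselect (exists m p q,
    [/\ poly_graph p q, p != 0, p.[b] = 0 & size p = m]); last first.
  exists 0 => p q Gpq pb; have p0 : p = 0.
    by apply: contrapT => /eqP p0; apply: trans_b; exists (size p), p, q.
  by move: Gpq; rewrite p0 => /poly_graph0 ->; rewrite horner0 mul0r addr0.
have exm : exists m, `[<exists p q,
    [/\ poly_graph p q, p != 0, p.[b] = 0 & size p = m]>].
  by have [m mP] := alg_b; exists m; apply/asboolP.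
case: (ex_minnP exm) => m /asboolP[p0 [q0 [G0p p0_neq0 p0b sp0]]] min.
have p0'b : p0^`().[b] != 0.
  apply/eqP => p0'b; have sp0' := lt_size_deriv p0_neq0.
  have p0'0 : p0^`() = 0.
    apply: contrapT => /eqP p0'0; move: sp0'; rewrite sp0 ltnNge => /negP; apply.
    apply: min; apply/asboolP; exists p0^`(), q0^`(); split=> //.
    exact: poly_graph_deriv.
  have : (size p0 <= 1)%N.
    apply/leq_sizeP => j j1; have := congr1 (fun p : {poly K} => p`_(j.-1)) p0'0.
    rewrite coef_deriv coef0 prednK // => /eqP; rewrite mulrn_eq0.
    by rewrite eqn0Ngt j1 => /eqP.
  move=> /size1_polyC p0C; move: p0_neq0 p0b; rewrite p0C hornerC polyC_eq0.
  by move=> /eqP.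
exists (- q0.[b] / p0^`().[b]); set c := _ / _ => p q.
have [s] := ubnP (size p); elim: s p q => // s IH p q; rewrite ltnS => sp Gpq pb.
have [p_eq0|p_neq0] := eqVneq p 0.
  by move: Gpq; rewrite p_eq0 => /poly_graph0 ->; rewrite deriv0 horner0 mulr0 addr0.
have le_p0p : (size p0 <= size p)%N.
  by rewrite sp0; apply: min; apply/asboolP; exists p, q.
set i0 := (size p0).-1; set i := (size p).-1; set d := (size p - size p0)%N.
pose p2 := (p0`_i0)%:P * 'X^0 * p - (p`_i)%:P * 'X^d * p0.
pose q2 := ((q0`_i0)%:P * 'X^0 * p + (p0`_i0)%:P * 'X^0 * q)
  - ((q`_i)%:P * 'X^d * p0 + (p`_i)%:P * 'X^d * q0).
have Gpq2 : poly_graph p2 q2.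
  by apply: poly_graphB; apply: poly_graphM => //; apply: poly_graphXn.
have p2b : p2.[b] = 0 by rewrite /p2 hornerD hornerN !hornerM pb p0b !mulr0 subr0.
have p00 : p0`_i0 != 0 by rewrite -/(lead_coef p0) lead_coef_eq0.
have sp2 : (size p2 < size p)%N.
  have sp_gt0 : (0 < size p)%N by rewrite size_poly_gt0.
  have sp0_gt0 : (0 < size p0)%N by rewrite size_poly_gt0.
  rewrite -[X in (_ < X)%N](prednK sp_gt0) ltnS; apply/leq_sizeP => j.
  rewrite leq_eqVlt /p2 => /predU1P[<-|ij].
    rewrite coefB expr0 mulr1 -mulrA !coefCM coefXnM.
    have -> : (i < d)%N = false.
      by apply/negbTE; rewrite -leqNgt /d /i -subn1 leq_sub2l.
    have -> : (i - d)%N = i0.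
      by rewrite /i /d /i0 -!subn1 subnAC subKn.
    by rewrite mulrC subrr.
  have spj : (size p <= j)%N by rewrite -(prednK sp_gt0).
  have sp0j : (size p0 <= j - d)%N.
    by rewrite leq_subRL ?(leq_trans (leq_subr _ _)) // subnK.
  rewrite coefB expr0 mulr1 -mulrA !coefCM coefXnM.
  by rewrite (nth_default _ spj) (nth_default _ sp0j) if_same !mulr0 subr0.
have := IH p2 q2 (leq_trans sp2 sp) Gpq2 p2b.
have p0c : q0.[b] + c * p0^`().[b] = 0 by rewrite /c divfK // subrr.
have -> : q2.[b] + c * p2^`().[b] = p0`_i0 * (q.[b] + c * p^`().[b]) -
    p`_i * b ^+ d * (q0.[b] + c * p0^`().[b]).
  rewrite /q2 /p2 !expr0 !mulr1 derivB !derivM !derivC.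
  rewrite !(hornerD, hornerN, hornerM, hornerC, hornerXn) pb p0b.
  by ring.
by rewrite p0c mulr0 subr0 => /eqP; rewrite mulf_eq0 (negPf p00) => /eqP.
Qed.

Lemma dual_gen_extend b c u v :
    dual_gen (fun u v => G u v \/ (u = b /\ v = c)) u v ->
  exists p q, [/\ poly_graph p q, u = p.[b] & v = q.[b] + c * p^`().[b]].
Proof.
elim=> {u v} [u v [Guv|[-> ->]]|u v u' v' _ [p [q [Gp -> ->]]] _ [p' [q' [Gp' -> ->]]]|
    u v u' v' _ [p [q [Gp -> ->]]] _ [p' [q' [Gp' -> ->]]]].
- exists u%:P, v%:P; split; rewrite ?derivC ?hornerC ?mulr0 ?addr0 //.
  by move=> i; rewrite !coefC; case: eqP.
- exists 'X, 0; split; rewrite ?derivX ?hornerX ?hornerC ?mulr1 ?add0r //.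
  by move=> i; rewrite coefX coef0; case: eqP.
- exists (p - p'), (q - q'); split; first exact: poly_graphB.
    by rewrite !hornerE.
  by rewrite derivB !hornerE; ring.
- exists (p * p'), (q * p' + p * q'); split; first exact: poly_graphM.
    by rewrite !hornerE.
  by rewrite derivM !hornerE; ring.
Qed.

End DualGraph.

(** Zorn's lemma gives a maximal graph that contains (a, 1) and maps F to 0; by
    [dual_graph_extend] its domain is K. *)
Lemma transcendental_derivation (K : numFieldType) (F : set K) (a : K) :
    F 1 -> (forall u v, F u -> F v -> F (u - v)) ->
    (forall u v, F u -> F v -> F (u * v)) ->
    (forall p : {poly K}, (forall i, F p`_i) -> p.[a] = 0 -> p = 0) ->
  exists D, [/\ derivation D, forall c, F c -> D c = 0 & D a = 1].
Proof.
move=> F1 FB FM trans_a; have F0 : F 0 by rewrite -(subrr 1); apply: FB.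
have FD u v : F u -> F v -> F (u + v).
  by move=> Fu Fv; rewrite -[v]opprK -(sub0r v); apply: (FB) => //; apply: FB.
pose base (u v : K) := (F u /\ v = 0) \/ (u = a /\ v = 1).
pose gen (A : set (K * K)) := dual_gen (fun u v => base u v \/ A (u, v)).
pose P A := forall v, gen A 0 v -> v = 0.
have base_poly u v : dual_gen base u v ->
    exists p : {poly K}, [/\ forall i, F p`_i, u = p.[a] & v = p^`().[a]].
  elim=> {u v} [u v [[Fu ->]|[-> ->]]|u v u' v' _ [p [Fp -> ->]] _ [q [Fq -> ->]]|
    u v u' v' _ [p [Fp -> ->]] _ [q [Fq -> ->]]].
  - exists u%:P; rewrite hornerC derivC horner0; split=> // i.
    by rewrite coefC; case: eqP.
  - exists 'X; rewrite hornerX derivX hornerC; split=> // i.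
    by rewrite coefX; case: eqP.
  - exists (p - q); rewrite derivB !hornerE; split=> // i.
    by rewrite coefB; apply: FB.
  - exists (p * q); rewrite derivM !hornerE; split=> //= i.
    rewrite coefM; apply: (big_ind F) => // j _; exact: FM.
have [A' A'tot A'P|A [PA maxA]] := @Zorn_bigcup _ P.
  have [A'0|/set0P[X0 AX0]] := eqVneq A' set0.
    have P0 v : dual_gen base 0 v -> v = 0.
      move=> /base_poly[p [Fp p0 ->]].
      by rewrite (trans_a p) // deriv0 horner0.
    move=> v gv; apply: P0; apply: dual_gen_sub gv => u w [//|[X]].
    by rewrite A'0.
  have genS X Y u v : X `<=` Y -> gen X u v -> gen Y u v.
    by move=> XY; apply: dual_gen_sub => u' v' [|/XY]; [left|right].
  suff fin u v : gen (\bigcup_(X in A') X) u v -> exists2 X, A' X & gen X u v.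
    by move=> v /fin[X AX]; apply: (A'tot X AX).
  elim=> {u v} [u v [buv|[X AX Xuv]]|u v u' v' _ [X AX Xu] _ [Y AY Yu]|
    u v u' v' _ [X AX Xu] _ [Y AY Yu]].
  - by exists X0 => //; apply: dual_mem; left.
  - by exists X => //; apply: dual_mem; right.
  - have [XY|YX] := A'P X Y AX AY; [exists Y => //|exists X => //]; apply: dual_sub => //.
      exact: genS Xu.
    exact: genS Yu.
  - have [XY|YX] := A'P X Y AX AY; [exists Y => //|exists X => //]; apply: dual_mul => //.
      exact: genS Xu.
    exact: genS Yu.
pose G := gen A.
have GF c : F c -> G c 0 by move=> Fc; apply: dual_mem; left; left.
have Ga : G a 1 by apply: dual_mem; left; right.
have GB u v u' v' : G u v -> G u' v' -> G (u - u') (v - v') by apply: dual_sub.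
have GM u v u' v' : G u v -> G u' v' -> G (u * u') (v * u' + u * v').
  exact: dual_mul.
have GD u v u' v' : G u v -> G u' v' -> G (u + u') (v + v').
  move=> Gu Gu'; rewrite -[u']opprK -[v']opprK; apply: (GB) => //.
  by rewrite -(sub0r u') -(sub0r v'); apply: (GB) => //; apply: GF.
have Guniq u v w : G u v -> G u w -> v = w.
  move=> Gv Gw; apply/eqP; rewrite -subr_eq0; apply/eqP/PA.
  by rewrite -(subrr u); apply: GB.
have /choice[D DP] b : exists c, G b c.
  have [c cP] := dual_graph_extend (GF _ F0) GB GM PA b.
  exists c; apply: contrapT => Gbc.
  have /existsNP[v /not_implyP[Gv v0]] : ~ P (A `|` [set (b, c)]).
    apply: maxA; split; first by left.
    by move=> sub; apply: Gbc; apply: dual_mem; right; apply: sub; right.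
  apply: v0; have : dual_gen (fun u v => G u v \/ (u = b /\ v = c)) 0 v.
    apply: dual_gen_sub Gv => u w [bu|[Au|[-> ->]]].
    - by left; apply: dual_mem; left.
    - by left; apply: dual_mem; right.
    - by right.
  move=> /(dual_gen_extend (GF _ F0) (GF _ F1) GB GM)[p [q [Gpq p0 ->]]].
  exact: cP.
exists D; split=> [|c Fc|].
- split=> x y; first by apply: Guniq (DP _) _; apply: GD.
  by apply: Guniq (DP _) _; apply: GM.
- by apply: Guniq (DP c) _; apply: GF.
- exact: Guniq (DP a) _.
Qed.

Lemma countable_enum (T : Type) (A : set T) : T -> countable A ->
  exists f : nat -> T, A `<=` range f.
Proof.
move=> x0 /countable_injP[g g_inj].
pose f k := if pselect (exists2 x, A x & g x = k) is left e
  then s2val (cid2 e) else x0.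
exists f => x Ax; exists (g x) => //; rewrite /f; case: pselect => [e|[]]; last by exists x.
by case: cid2 => y Ay gy /=; apply: g_inj gy; rewrite inE.
Qed.

Section CountableField.
Variables (K : numFieldType) (E : set K).
Hypothesis countableE : countable E.

Definition constants : set K :=
  [set a | forall D, derivation D -> (forall e, E e -> D e = 0) -> D a = 0].

Lemma constants_sub e : E e -> constants e.
Proof. by move=> Ee D _; apply. Qed.

Lemma constants0 : constants 0.
Proof. by move=> D dD _; apply: derivation0. Qed.

Lemma constants1 : constants 1.
Proof. by move=> D dD _; apply: derivation1. Qed.

Lemma constantsD a b : constants a -> constants b -> constants (a + b).
Proof.
move=> ca cb D dD DE.
by rewrite derivationD // (ca _ dD DE) (cb _ dD DE) addr0.
Qed.

Lemma constantsM a b : constants a -> constants b -> constants (a * b).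
Proof.
move=> ca cb D dD DE.
by rewrite derivationM // (ca _ dD DE) (cb _ dD DE) mulr0 mul0r addr0.
Qed.

(** The constants are algebraic over the countable ring generated by E, by
    [transcendental_derivation]. *)
Lemma countable_constants : countable constants.
Proof.
have [e eE] := countable_enum 0 countableE.
(* The elements of this ring are the values of trees with leaves in E. *)
pose ev := fix ev (t : GenTree.tree nat) : K := match t with
  | GenTree.Leaf k => e k
  | GenTree.Node 0 [:: s; t] => ev s - ev t
  | GenTree.Node 1 [:: s; t] => ev s * ev t
  | _ => 1 end.
pose rts (s : seq (GenTree.tree nat)) : set K :=
  if Poly (map ev s) == 0 then set0 else [set x | root (Poly (map ev s)) x].
apply: (@sub_countable _ _ _ (\bigcup_(s in [set: seq (GenTree.tree nat)]) rts s)).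
  apply: subset_card_le => a ca; apply: contrapT => na.
  have [||||D [dD D0 Da]] := @transcendental_derivation K (range ev) a.
  - by exists (GenTree.Node 2 [::]).
  - by move=> _ _ [s _ <-] [t _ <-]; exists (GenTree.Node 0 [:: s; t]).
  - by move=> _ _ [s _ <-] [t _ <-]; exists (GenTree.Node 1 [:: s; t]).
  - move=> p Fp pa; have /choice[t tP] i : exists t, ev t = p`_i.
      by have [t _ tE] := Fp i; exists t.
    apply: contrapT => /eqP p0; apply: na.
    have pE : Poly (map ev (mkseq t (size p))) = p.
      apply/polyP => i; rewrite coef_Poly -map_comp.
      have [ip|ip] := ltnP i (size p); last first.
        by rewrite !nth_default // size_map size_iota.
      by rewrite (nth_map 0%N) ?size_iota //= nth_iota // tP.
    by exists (mkseq t (size p)) => //; rewrite /rts pE (negPf p0); apply/eqP.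
  have /eqP : D a = 0; last by rewrite Da oner_eq0.
  by apply: ca => // x /eE[k _ <-]; apply: D0; exists (GenTree.Leaf k).
apply: bigcup_countable; first exact: countableP.
move=> s _; rewrite /rts; case: eqP => [_|/eqP p0]; first exact: countable0.
apply: finite_set_countable; apply: contrapT => /infinite_tuple.
move=> /(_ (size (Poly (map ev s))))[r r_inj r_root].
set p := Poly (map ev s) in p0 r r_inj r_root *.
have all_r : all (root p) (map r (enum 'I_(size p))).
  by apply/allP => _ /mapP[i _ ->]; apply: r_root.
have := max_poly_roots p0 all_r.
by rewrite map_inj_uniq // enum_uniq size_map size_enum_ord ltnn => /(_ isT).
Qed.

End CountableField.

(** * Fields of definition *)

Section CoefficientDerivation.
Variables (K : fieldType) (n : nat) (D : K -> K).
Hypothesis derD : derivation D.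
Implicit Types p q : mpoly n K.

Definition coef_derivation p : mpoly n K :=
  \sum_(m <- msupp p) D (mcoeff m p) *: mpolyX K m.

Lemma mcoeff_coef_derivation p m :
  mcoeff m (coef_derivation p) = D (mcoeff m p).
Proof.
rewrite /coef_derivation raddf_sum /=.
have [mp|mp] := boolP (m \in msupp p).
  rewrite (bigD1_seq m) ?msupp_uniq //= mcoeffZ mcoeffX eqxx mulr1 big1 ?addr0 //.
  by move=> k km; rewrite mcoeffZ mcoeffX (negPf km) mulr0.
rewrite big_seq big1 => [|k kp].
  by rewrite (memN_msupp_eq0 mp) derivation0.
by rewrite mcoeffZ mcoeffX; case: eqP => [km|_]; rewrite ?mulr0 // -km kp in mp *.
Qed.

Lemma derivation_meval_monomial (v : 'I_n -> K) m :
  D (meval v (mpolyX K m)) = \sum_i meval v (mderiv i (mpolyX K m)) * D (v i).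
Proof.
pose P p := D (meval v p) = \sum_i meval v (mderiv i p) * D (v i).
have P1 : P 1.
  rewrite /P meval1 derivation1 // big1 // => i _.
  by rewrite -mpolyC1 mderivC meval0 mul0r.
have PM p q : P p -> P q -> P (p * q).
  rewrite /P mevalM derivationM // => -> ->.
  rewrite mulr_suml mulr_sumr -big_split /=; apply: eq_bigr => i _.
  by rewrite mderivM mevalD !mevalM; ring.
rewrite -/(P _) mpolyXE_id; apply: (big_ind P P1 PM) => i _.
elim: (m i) => [|k IH]; first by rewrite expr0.
rewrite exprS; apply: PM => //; rewrite /P mevalXU (bigD1 i) //= big1 => [|j ji].
  rewrite mderivX mnm1E eqxx -[X in mnm_sub X _]add0m addmK mpolyX0 scale1r.
  by rewrite meval1 mul1r addr0.
by rewrite mderivX mnm1E eq_sym (negPf ji) scale0r meval0 mul0r.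
Qed.

(** The chain rule for a derivation of the field of coefficients. *)
Lemma derivation_meval (v : 'I_n -> K) p :
  D (meval v p) =
    meval v (coef_derivation p) + \sum_i meval v (mderiv i p) * D (v i).
Proof.
have dE i : meval v (mderiv i p) =
    \sum_(m <- msupp p) mcoeff m p * meval v (mderiv i (mpolyX K m)).
  rewrite {1}[p]mpolyE [mderiv i _]raddf_sum [meval v _]raddf_sum.
  by apply: eq_bigr => m _; rewrite -mevalZ; congr meval; exact: mderivZ.
under eq_bigr do rewrite dE mulr_suml.
rewrite {1}[p]mpolyE /coef_derivation !raddf_sum /= derivation_sum //.
rewrite exchange_big /= -big_split /=; apply: eq_bigr => m _.
rewrite !mevalZ derivationM // derivation_meval_monomial; congr (_ + _).
by rewrite mulr_sumr; apply: eq_bigr => i _; rewrite mulrA.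
Qed.

End CoefficientDerivation.

Section FieldOfDefinition.
Variables (K : numFieldType) (n : nat) (E : set K).
Implicit Types (p q f g : mpoly n K) (I P : set (mpoly n K)).

Definition constant_coefs : set (mpoly n K) :=
  [set p | forall m, constants E (mcoeff m p)].

Lemma constant_coefs1 : constant_coefs 1.
Proof.
move=> m; rewrite mcoeff1.
by case: eqP => _; [exact: constants1|exact: constants0].
Qed.

Lemma constant_coefsM p q :
  constant_coefs p -> constant_coefs q -> constant_coefs (p * q).
Proof.
move=> cp cq m; rewrite mcoeffM; apply: (big_ind (constants E)).
- exact: constants0.
- exact: constantsD.
- by move=> k _; apply: constantsM.
Qed.

Lemma countable_constant_coefs : countable E -> countable constant_coefs.
Proof.
move=> /countable_constants/(countable_enum 0)[e eE].
pose F (s : seq (nat * multinom n)) : mpoly n K :=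
  \sum_(x <- s) e x.1 *: mpolyX K x.2.
apply: (@sub_countable _ _ _ (range F)); last first.
  exact/(sub_countable (card_image_le _ _))/countableP.
apply: subset_card_le => p cp.
have /choice[k kE] m : exists k, e k = mcoeff m p.
  by have [k _] := eE _ (cp m); exists k.
exists [seq (k m, m) | m <- msupp p] => //; rewrite /F big_map [RHS]mpolyE.
by apply: eq_bigr => m _; rewrite kE.
Qed.

(** An element of I whose support is minimal, scaled to have a coefficient 1, has
    derivatives with a smaller support, which are therefore 0. Hence the subspace I is
    spanned by its elements with constant coefficients. *)
Lemma derivation_stable_ind I P :
    (forall f g, I f -> I g -> I (f + g)) -> (forall c f, I f -> I (c *: f)) ->
    (forall D f, derivation D -> (forall e, E e -> D e = 0) ->
       I f -> I (coef_derivation D f)) ->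
    P 0 -> (forall f g, P f -> P g -> P (f + g)) ->
    (forall c f, P f -> P (c *: f)) ->
  I `&` constant_coefs `<=` P -> I `<=` P.
Proof.
move=> ID IZ Ider P0 PD PZ IP f.
have [k] := ubnP (size (msupp f)); elim: k f => // k IH f; rewrite ltnS => fk If.
have [->//|f0] := eqVneq f 0.
have smaller p q m : {subset msupp p <= msupp q} -> m \in msupp q ->
    mcoeff m p = 0 -> (size (msupp p) < size (msupp q))%N.
  move=> pq mq mp; apply: (@uniq_leq_size _ (m :: msupp p)).
    by rewrite /= msupp_uniq mcoeff_msupp mp eqxx.
  by move=> j; rewrite inE => /predU1P[->//|/pq].
have exm : exists k, `[<exists g,
    [/\ I g, g != 0, {subset msupp g <= msupp f} & size (msupp g) = k]>].
  by exists (size (msupp f)); apply/asboolP; exists f; split.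
case: (ex_minnP exm) => l /asboolP[g' [Ig' g'0 g'f g'l]] min.
pose c := mcoeff (mlead g') g'; have c0 : c != 0 by rewrite mleadc_eq0.
pose g := c^-1 *: g'; set m0 := mlead g'.
have gm0 : mcoeff m0 g = 1 by rewrite mcoeffZ mulVf.
have Ig : I g by apply: IZ.
have m0f : m0 \in msupp f by apply/g'f/mlead_supp.
have supp_g : msupp g =i msupp g'.
  by move=> m; rewrite !mcoeff_msupp mcoeffZ mulf_eq0 invr_eq0 (negPf c0).
have cg : constant_coefs g.
  move=> m D dD DE; rewrite -mcoeff_coef_derivation //.
  apply: contrapT => /eqP h0; set h := coef_derivation D g in h0.
  have hg : {subset msupp h <= msupp g'}.
    move=> j; rewrite -supp_g !mcoeff_msupp mcoeff_coef_derivation //.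
    by apply: contraNneq => ->; rewrite derivation0.
  have : (size (msupp h) < size (msupp g'))%N.
    apply: (@smaller _ _ m0) => //; first exact: mlead_supp.
    by rewrite mcoeff_coef_derivation // gm0 derivation1.
  rewrite g'l ltnNge => /negP; apply; apply: min; apply/asboolP; exists h; split=> //.
  - exact: Ider.
  - by apply: contraNneq h0 => ->; rewrite mcoeff0.
  - by move=> j /hg/g'f.
rewrite -(subrK (mcoeff m0 f *: g) f); apply: PD; last first.
  by apply/PZ/IP.
have sub_h : {subset msupp (f - mcoeff m0 f *: g) <= msupp f}.
  move=> j /msuppB_le; rewrite mem_cat => /orP[//|/msuppZ_le].
  by rewrite supp_g => /g'f.
apply: IH; last by apply: ID => //; rewrite -scaleN1r scalerA; apply: IZ.
apply: leq_trans fk; apply: (@smaller _ _ m0) => //.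
by rewrite mcoeffB mcoeffZ gm0 mulr1 subrr.
Qed.

End FieldOfDefinition.

(** * Images of polynomial maps *)

Section ConstructibleImage.
Variables (K : closedFieldType) (N M : nat).

Definition env (x : 'I_N -> K) : seq K := codom x.

Lemma nth_env x (i : 'I_N) : (env x)`_i = x i.
Proof. by rewrite /env codomE (nth_map i) ?size_enum_ord // nth_ord_enum. Qed.

Lemma quantifier_elimination (f : GRing.formula K) : exists g,
  [/\ GRing.qf_form g, GRing.rformula g
    & forall e, GRing.holds e f <-> GRing.qf_eval e g].
Proof.
pose g := GRing.quantifier_elim (@ClosedFieldQE.ex_elim K) (GRing.to_rform f).
have rf : GRing.rformula (GRing.to_rform f) by apply: GRing.to_rform_rformula.
have /andP[gq gr] := GRing.quantifier_elim_wf (@ClosedFieldQE.wf_ex_elim K) rf.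
exists g; split=> // e.
have QE := GRing.quantifier_elim_rformP (@ClosedFieldQE.wf_ex_elim K)
  (ClosedFieldQE.holds_ex_elim (@solve_monicpoly K)) e rf.
by split=> [/GRing.to_rformP/QE|/QE/GRing.to_rformP].
Qed.

Fixpoint term_mpoly (t : GRing.term K) : mpoly N K :=
  match t with
  | GRing.Var k => if insub k is Some i then mpolyX K (mnm1 i) else 0
  | GRing.Const c => mpolyC N c
  | GRing.NatConst k => k%:R
  | GRing.Add a b => term_mpoly a + term_mpoly b
  | GRing.Opp a => - term_mpoly a
  | GRing.NatMul a k => term_mpoly a *+ k
  | GRing.Mul a b => term_mpoly a * term_mpoly b
  | GRing.Inv a => 0
  | GRing.Exp a k => term_mpoly a ^+ k
  end.

Lemma meval_term_mpoly t x : GRing.rterm t ->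
  meval x (term_mpoly t) = GRing.eval (env x) t.
Proof.
elim: t => //= [k|c _|k _|a IHa b IHb /andP[/IHa <- /IHb <-]|a IH /IH <-|
  a IH k /IH <-|a IHa b IHb /andP[/IHa <- /IHb <-]|a IH k /IH <-].
- case: insubP => [i _ <-|]; first by rewrite mevalXU nth_env.
  by rewrite -leqNgt => Nk; rewrite meval0 nth_default // size_codom card_ord.
- exact: mevalC.
- exact: rmorph_nat.
- exact: mevalD.
- exact: mevalN.
- exact: mevalMn.
- exact: mevalM.
- exact: rmorphXn.
Qed.

(** An atomic formula says that a polynomial is 0. If this does not hold at all the
    points of X where h0 <> 0, multiplying h0 by this polynomial makes it false. *)
Lemma qf_generic (f : GRing.formula K) (X : set ('I_N -> K)) h0 :
    GRing.qf_form f -> GRing.rformula f -> (exists2 x, X x & meval x h0 != 0) ->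
  exists h b, [/\ exists2 x, X x & meval x h != 0,
    forall x, meval x h != 0 -> meval x h0 != 0
    & forall x, X x -> meval x h != 0 -> GRing.qf_eval (env x) f = b].
Proof.
elim: f h0 => //= [b|a b|f IHf g IHg|f IHf g IHg|f IHf g IHg|f IHf] h0.
- by move=> _ _ Xh0; exists h0, b.
- move=> _ /andP[ra rb] [x Xx xh0].
  have [eq_ab|] := pselect (forall x, X x -> meval x h0 != 0 ->
      meval x (term_mpoly a - term_mpoly b) = 0).
    exists h0, true; split=> //; first by exists x.
    move=> u Xu uh0; apply/eqP/eqP; rewrite -!meval_term_mpoly // -subr_eq0.
    by rewrite -mevalB eq_ab.
  move=> /existsNP[u /not_implyP[Xu /not_implyP[uh0 /eqP uab]]].
  exists (h0 * (term_mpoly a - term_mpoly b)), false; split.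
  - by exists u; rewrite // mevalM mulf_neq0.
  - by move=> w; rewrite mevalM mulf_eq0 negb_or => /andP[].
  move=> w _; rewrite mevalM mulf_eq0 negb_or => /andP[_].
  by rewrite mevalB subr_eq0 !meval_term_mpoly // => /negPf.
- move=> /andP[qf qg] /andP[rf rg] /(IHf _ qf rf)[h1 [b1 [Xh1 h10 h1f]]].
  have [h [b2 [Xh hh1 hg]]] := IHg _ qg rg Xh1.
  by exists h, (b1 && b2); split=> [//|x /hh1/h10//|x Xx hx]; rewrite h1f ?hg ?hh1.
- move=> /andP[qf qg] /andP[rf rg] /(IHf _ qf rf)[h1 [b1 [Xh1 h10 h1f]]].
  have [h [b2 [Xh hh1 hg]]] := IHg _ qg rg Xh1.
  by exists h, (b1 || b2); split=> [//|x /hh1/h10//|x Xx hx]; rewrite h1f ?hg ?hh1.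
- move=> /andP[qf qg] /andP[rf rg] /(IHf _ qf rf)[h1 [b1 [Xh1 h10 h1f]]].
  have [h [b2 [Xh hh1 hg]]] := IHg _ qg rg Xh1.
  by exists h, (b1 ==> b2); split=> [//|x /hh1/h10//|x Xx hx]; rewrite h1f ?hg ?hh1.
- move=> qf rf /(IHf _ qf rf)[h [b [Xh h10 hf]]].
  by exists h, (~~ b); split=> // x Xx hx; rewrite hf.
Qed.

Definition mpoly_term (sigma : 'I_M -> GRing.term K) (p : mpoly M K) :=
  foldr (fun m => GRing.Add (GRing.Mul (GRing.Const (mcoeff m p))
    (foldr (fun i => GRing.Mul (GRing.Exp (sigma i) (m i))) (GRing.Const 1)
      (enum 'I_M)))) (GRing.Const 0) (msupp p).

Lemma eval_mpoly_term e sigma p :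
  GRing.eval e (mpoly_term sigma p) = meval (fun i => GRing.eval e (sigma i)) p.
Proof.
rewrite mevalE /mpoly_term; elim: (msupp p) => [|m s IH] /=; first by rewrite big_nil.
rewrite big_cons IH; congr (_ * _ + _); rewrite -big_enum /=.
by elim: (enum 'I_M) => [|i l IHl] /=; rewrite ?big_nil // big_cons IHl.
Qed.

(** Chevalley's theorem on images, as a consequence of quantifier elimination: a
    constructible set contains or avoids a nonempty relatively open subset of X. *)
Theorem constructible_image (s : seq (mpoly M K)) (q : mpoly M K)
    (phi : 'I_N -> mpoly M K) (X : set ('I_N -> K)) : X !=set0 ->
  exists h, (exists2 x, X x & meval x h != 0) /\ exists b : bool,
    forall x, X x -> meval x h != 0 ->
      (exists u, [/\ forall p, p \in s -> meval u p = 0, meval u q != 0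
        & forall i, meval u (phi i) = x i]) <-> b.
Proof.
move=> [x0 Xx0]; pose sigma (i : 'I_M) : GRing.term K := GRing.Var K (N + i).
pose eq0 (t : GRing.term K) := GRing.Equal t (GRing.Const 0).
pose conj := foldr (@GRing.And K) (GRing.Bool true).
pose f0 := GRing.And (conj [seq eq0 (mpoly_term sigma p) | p <- s])
  (GRing.And (GRing.Not (eq0 (mpoly_term sigma q)))
    (conj [seq GRing.Equal (mpoly_term sigma (phi i)) (GRing.Var K i) | i : 'I_N])).
have conjP e (T : eqType) (l : seq T) (F : T -> GRing.formula K) :
    GRing.holds e (conj (map F l)) <-> forall x, x \in l -> GRing.holds e (F x).
  elim: l => [|y l IH] /=; first by split.
  split=> [[ey /IH el] x|H]; first by rewrite inE => /predU1P[->//|/el].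
  by split; [|apply/IH => x xl]; apply: H; rewrite inE ?eqxx // xl orbT.
have [g [gq gr gP]] := quantifier_elimination (foldr GRing.Exists f0 (iota N M)).
have [|h [b [Xh _ hb]]] := @qf_generic g X 1 gq gr.
  by exists x0; rewrite // meval1 oner_eq0.
exists h; split=> //; exists b => x Xx hx; rewrite -(hb x Xx hx) -gP -GRing.foldExistsP.
have f0P e u : (forall i : 'I_M, e`_(N + i) = u i) -> (forall i : 'I_N, e`_i = x i) ->
    GRing.holds e f0 <-> [/\ forall p, p \in s -> meval u p = 0, meval u q != 0
        & forall i, meval u (phi i) = x i].
  move=> eu ex; have evE p : GRing.eval e (mpoly_term sigma p) = meval u p.
    by rewrite eval_mpoly_term; apply: meval_eq => i; exact: eu.
  split=> [[/conjP Hs [/= Hq /conjP Hphi]]|[Hs Hq Hphi]].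
    split; first by move=> p /Hs /=; rewrite evE.
      by apply/eqP; rewrite -evE.
    by move=> i; have /= := Hphi i (mem_enum _ _); rewrite evE ex.
  split; first by apply/conjP => p /Hs /=; rewrite evE.
  split; first by rewrite /= evE; apply/eqP.
  by apply/conjP => i _ /=; rewrite evE ex.
split=> [[u uP]|[e exe /=]].
  pose e := env x ++ codom u.
  have ex (i : 'I_N) : e`_i = x i.
    by rewrite nth_cat size_codom card_ord ltn_ord nth_env.
  exists e; last first.
    apply/(f0P e u) => // i.
    rewrite nth_cat size_codom card_ord ltnNge leq_addr addKn /=.
    by rewrite codomE (nth_map i) ?size_enum_ord // nth_ord_enum.
  move=> i; rewrite inE mem_iota negb_and -!ltnNge ltnS => /orP[iN|iNM].
    by rewrite nth_cat size_codom card_ord iN.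
  rewrite !nth_default // ?size_cat ?size_codom ?card_ord //.
  by apply: leq_trans iNM; apply: leq_addr.
move=> ef0; exists (fun i => e`_(N + i)); apply/(f0P e) => // i.
rewrite -exe ?nth_env // inE mem_iota negb_and -ltnNge.
by rewrite ltn_ord.
Qed.

End ConstructibleImage.

(** * Polynomials in the entries of a matrix *)

Lemma map_derivationM (K : fieldType) n (D : K -> K) (a b : 'M[K]_n) :
    derivation D ->
  map_mx D (a *m b) = map_mx D a *m b + a *m map_mx D b.
Proof.
move=> dD; apply/matrixP => i j; rewrite !mxE derivation_sum // -big_split /=.
by apply: eq_bigr => k _; rewrite !mxE derivationM.
Qed.

Section MatrixPolynomials.
Variables (K : numFieldType) (n : nat).
Implicit Types (A B X Y g h : 'M[K]_n) (p q : mpoly (n * n) K).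

Definition mxeval A p := meval (mxvec A 0) p.

(** The differential of p at A in the direction X. *)
Definition mxdiff p A X := \sum_k mxeval A (mderiv k p) * mxvec X 0 k.

Lemma mxeval0 A : mxeval A 0 = 0. Proof. exact: meval0. Qed.

Lemma mxevalD A p q : mxeval A (p + q) = mxeval A p + mxeval A q.
Proof. exact: mevalD. Qed.

Lemma mxevalM A p q : mxeval A (p * q) = mxeval A p * mxeval A q.
Proof. exact: mevalM. Qed.

Lemma mxevalX A p k : mxeval A (p ^+ k) = mxeval A p ^+ k.
Proof. exact: rmorphXn. Qed.

Lemma mxevalMn A p k : mxeval A (p *+ k) = mxeval A p *+ k.
Proof. exact: mevalMn. Qed.

Lemma mxdiffM p q A X :
  mxdiff (p * q) A X = mxdiff p A X * mxeval A q + mxeval A p * mxdiff q A X.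
Proof.
rewrite /mxdiff mulr_suml mulr_sumr -big_split /=; apply: eq_bigr => k _.
by rewrite mderivM /mxeval mevalD !mevalM; ring.
Qed.

Lemma mxdiffD p A X Y : mxdiff p A (X + Y) = mxdiff p A X + mxdiff p A Y.
Proof.
rewrite /mxdiff -big_split /=; apply: eq_bigr => k _.
by rewrite linearD mxE mulrDr.
Qed.

Lemma mxdiffZ p A c X : mxdiff p A (c *: X) = c * mxdiff p A X.
Proof.
rewrite /mxdiff mulr_sumr; apply: eq_bigr => k _.
by rewrite linearZ mxE mulrCA.
Qed.

Lemma derivation_mxeval (D : K -> K) A p : derivation D ->
  D (mxeval A p) = mxeval A (coef_derivation D p) + mxdiff p A (map_mx D A).
Proof.
move=> dD; rewrite /mxeval derivation_meval //; congr (_ + _).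
by apply: eq_bigr => k _; rewrite -map_mxvec mxE.
Qed.

(** The differential is a derivative along a line, so that it is determined by the
    values of p. *)
Lemma mxdiff_line p A X : exists l : {poly K},
  (forall t, l.[t] = mxeval (A + t *: X) p) /\ l^`().[0] = mxdiff p A X.
Proof.
elim/mpoly_alg_ind: p => [c|i|p q [l [lE dl]] [m [mE dm]]|p q [l [lE dl]] [m [mE dm]]].
- exists c%:P; split=> [t|]; first by rewrite hornerC /mxeval mevalC.
  rewrite derivC horner0 /mxdiff big1 // => k _.
  by rewrite mderivC /mxeval meval0 mul0r.
- exists ((mxvec A 0 i)%:P + (mxvec X 0 i)%:P * 'X); split=> [t|].
    by rewrite !hornerE /mxeval mevalXU linearD linearZ !mxE mulrC.
  rewrite derivD derivC derivM derivC derivX !hornerE /mxdiff (bigD1 i) //= big1.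
    by rewrite mderivX mnm1E eqxx -[X in mnm_sub X _]add0m addmK mpolyX0 scale1r
      /mxeval meval1 mul1r addr0.
  move=> k ki; rewrite mderivX mnm1E eq_sym (negPf ki) scale0r.
  by rewrite /mxeval meval0 mul0r.
- exists (l + m); split=> [t|]; first by rewrite hornerD lE mE /mxeval mevalD.
  rewrite derivD hornerD dl dm /mxdiff -big_split /=; apply: eq_bigr => k _.
  by rewrite mderivD /mxeval mevalD mulrDl.
- exists (l * m); split=> [t|]; first by rewrite hornerM lE mE /mxeval mevalM.
  rewrite derivM hornerD !hornerM dl dm lE mE mxdiffM.
  by rewrite scale0r addr0 addrC.
Qed.

Lemma horner_inj (l m : {poly K}) : (forall t, l.[t] = m.[t]) -> l = m.
Proof.
move=> lm; apply/eqP; rewrite -subr_eq0; apply/eqP.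
apply: (@roots_geq_poly_eq0 _ _ [seq i%:R | i <- iota 0 (size (l - m))]).
- by apply/allP => t _; rewrite /root hornerD hornerN lm subrr.
- by rewrite map_inj_uniq ?iota_uniq // => i j /eqP; rewrite eqr_nat => /eqP.
- by rewrite size_map size_iota.
Qed.

Lemma mxdiff_eq p A X q B Y :
    (forall t, mxeval (A + t *: X) p = mxeval (B + t *: Y) q) ->
  mxdiff p A X = mxdiff q B Y.
Proof.
move=> pq; have [l [lE <-]] := mxdiff_line p A X.
have [m [mE <-]] := mxdiff_line q B Y.
by rewrite (@horner_inj l m) // => t; rewrite lE mE.
Qed.

Definition pullback (f : {linear 'M[K]_n -> 'M[K]_n}) p : mpoly (n * n) K :=
  comp_mpoly [tuple \sum_j mpolyC _ (lin_mx f j k) * mpolyX K (mnm1 j) | k < n * n] p.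

Lemma mxeval_pullback f p A : mxeval A (pullback f p) = mxeval (f A) p.
Proof.
rewrite /mxeval comp_mpoly_meval; apply: meval_eq => k.
rewrite tnth_mktuple raddf_sum /= -mul_vec_lin mxE; apply: eq_bigr => j _.
by rewrite mevalM mevalC mevalXU mulrC.
Qed.

Lemma mxdiff_pullback f p A X :
  mxdiff (pullback f p) A X = mxdiff p (f A) (f X).
Proof. by apply: mxdiff_eq => t; rewrite mxeval_pullback linearD linearZ. Qed.

Definition generic_mx : 'M[mpoly (n * n) K]_n :=
  vec_mx (\row_k mpolyX K (mnm1 k)).

Lemma generic_mxE i j : generic_mx i j = mpolyX K (mnm1 (mxvec_index i j)).
Proof. by rewrite !mxE. Qed.

Lemma mxeval_generic A i j : mxeval A (generic_mx i j) = A i j.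
Proof. by rewrite generic_mxE /mxeval mevalXU mxvecE. Qed.

Lemma map_generic_mx A : map_mx (meval (mxvec A 0)) generic_mx = A.
Proof.
rewrite /generic_mx map_vec_mx -[RHS]mxvecK; congr vec_mx.
by apply/rowP => k; rewrite !mxE mevalXU.
Qed.

Lemma map_mpolyC_mx (A B : 'M[K]_n) :
  map_mx (meval (mxvec A 0)) (map_mx (@mpolyC (n * n) K) B) = B.
Proof. by apply/matrixP => i j; rewrite !mxE mevalC. Qed.

Lemma mxeval_det A : mxeval A (\det generic_mx) = \det A.
Proof. by rewrite /mxeval -det_map_mx map_generic_mx. Qed.

(** The left-invariant vector field on GL_n with value X at the identity. *)
Definition left_invariant X p : mpoly (n * n) K :=
  \sum_k mderiv k p * mxvec (generic_mx *m map_mx (@mpolyC (n * n) K) X) 0 k.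

Lemma mxeval_left_invariant X p A :
  mxeval A (left_invariant X p) = mxdiff p A (A *m X).
Proof.
rewrite /mxeval raddf_sum /=; apply: eq_bigr => k _; rewrite mevalM; congr (_ * _).
transitivity (map_mx (meval (mxvec A 0))
  (mxvec (generic_mx *m map_mx (@mpolyC (n * n) K) X)) 0 k); first by rewrite mxE.
by rewrite map_mxvec map_mxM map_generic_mx map_mpolyC_mx.
Qed.

Lemma left_invariantD X p q :
  left_invariant X (p + q) = left_invariant X p + left_invariant X q.
Proof.
rewrite /left_invariant -big_split /=; apply: eq_bigr => k _.
by rewrite mderivD mulrDl.
Qed.

Lemma left_invariantM X p q :
  left_invariant X (p * q) = left_invariant X p * q + p * left_invariant X q.
Proof.
rewrite /left_invariant mulr_suml mulr_sumr -big_split /=; apply: eq_bigr => k _.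
by rewrite mderivM; ring.
Qed.

Lemma left_invariantC X c : left_invariant X (mpolyC _ c) = 0.
Proof. by rewrite /left_invariant big1 // => k _; rewrite mderivC mul0r. Qed.

Lemma left_invariant_generic X i j : left_invariant X (generic_mx i j) =
  (generic_mx *m map_mx (@mpolyC (n * n) K) X) i j.
Proof.
rewrite -[RHS]mxvecE /left_invariant (bigD1 (mxvec_index i j)) //= big1 ?addr0.
  rewrite generic_mxE mderivX mnm1E eqxx -[X in mnm_sub X _]add0m addmK.
  by rewrite mpolyX0 scale1r mul1r.
move=> k ki; rewrite generic_mxE mderivX mnm1E eq_sym (negPf ki) scale0r.
by rewrite mul0r.
Qed.

Definition commutator_mx Y : 'M[mpoly (n * n) K]_n :=
  generic_mx *m map_mx (@mpolyC (n * n) K) Y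
  - map_mx (@mpolyC (n * n) K) Y *m generic_mx.

Lemma mxeval_commutator Y A i j :
  mxeval A (commutator_mx Y i j) = (A *m Y - Y *m A) i j.
Proof.
have <- : map_mx (meval (mxvec A 0)) (commutator_mx Y) = A *m Y - Y *m A.
  by rewrite map_mxB !map_mxM map_generic_mx map_mpolyC_mx.
by rewrite [RHS]mxE.
Qed.

Lemma left_invariant_commutator X Y i j : X *m Y = Y *m X ->
  left_invariant X (commutator_mx Y i j) =
    (commutator_mx Y *m map_mx (@mpolyC (n * n) K) X) i j.
Proof.
move=> XY; pose GX := generic_mx; pose C B := map_mx (@mpolyC (n * n) K) B : 'M_n.
pose delta := left_invariant X.
have deltaD : {morph delta : p q / p + q} by apply: left_invariantD.
have deltaM p r : delta (p * r) = delta p * r + p * delta r.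
  exact: left_invariantM.
have delta0 : delta 0 = 0 by apply: (addrI (delta 0)); rewrite -deltaD !addr0.
have deltaN u : delta (- u) = - delta u.
  by apply: (addrI (delta u)); rewrite -deltaD !subrr.
have CE B k l : C B k l = mpolyC (n * n) (B k l) by rewrite mxE.
have deltaMC B : delta ((GX *m C B) i j) = (GX *m C X *m C B) i j.
  rewrite !mxE (big_morph delta deltaD delta0).
  apply: eq_bigr => l _; rewrite deltaM [delta (C _ _ _)]/delta CE left_invariantC.
  by rewrite mulr0 addr0 [delta _]left_invariant_generic.
have deltaCM B : delta ((C B *m GX) i j) = (C B *m GX *m C X) i j.
  rewrite -mulmxA !mxE (big_morph delta deltaD delta0).
  apply: eq_bigr => l _; rewrite deltaM [delta (C _ _ _)]/delta CE left_invariantC.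
  by rewrite mul0r add0r [delta _]left_invariant_generic.
have subE (P Q : 'M[mpoly (n * n) K]_n) : (P - Q) i j = P i j - Q i j.
  by rewrite !mxE.
have CC : C X *m C Y = C Y *m C X by rewrite /C -!map_mxM XY.
rewrite -/(delta _) /commutator_mx mulmxBl [X in delta X]subE [RHS]subE.
by rewrite [LHS]deltaD deltaN (deltaMC Y) (deltaCM Y) -(mulmxA GX) CC mulmxA.
Qed.

End MatrixPolynomials.

(** All the terms of the Leibniz expansion but those in which each factor is derived
    once keep a factor f. *)
Lemma iter_derivation_exp (A : comNzRingType) (d : A -> A) :
    {morph d : x y / x + y} -> (forall x y, d (x * y) = d x * y + x * d y) ->
  forall f m, exists r, iter m d (f ^+ m) = d f ^+ m *+ m`! + f * r.
Proof.
move=> dD dM f m.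
have d0 : d 0 = 0 by apply: (addrI (d 0)); rewrite -dD !addr0.
have dMn x k : d (x *+ k) = d x *+ k.
  by elim: k => [//|k IH]; rewrite !mulrS dD IH.
have dX x k : d (x ^+ k.+1) = d x * x ^+ k *+ k.+1.
  elim: k => [|k IH]; first by rewrite expr1 expr0 mulr1.
  by rewrite exprS dM IH mulrnAr mulrCA -exprS -mulrS.
have dXn j k : exists r, iter j d (f ^+ (j + k)) =
    d f ^+ j * f ^+ k *+ (j + k) ^_ j + f ^+ k.+1 * r.
  elim: j k => [|j IH] k; first by exists 0; rewrite mul1r mulr0 addr0.
  have [r rE] := IH k.+1; set c := ((j + k.+1) ^_ j)%N in rE.
  exists (d (d f ^+ j) *+ c + d f * r *+ k.+2 + f * d r).
  rewrite iterS -addSnnS in rE *; rewrite rE dD dMn.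
  rewrite (dM (d f ^+ j)) (dM (f ^+ k.+2)) !dX ffactnSr.
  rewrite addSnnS -/c addKn mulrnA !exprS.
  move: (k.+2) c {rE} (d (d f ^+ j)) (d f ^+ j) (f ^+ k) (d f) (d r).
  by move=> a b u v w x y; ring.
by have [r] := dXn m 0; rewrite addn0 expr0 mulr1 expr1 ffactnn => ->; exists r.
Qed.

(** * The Lie algebra of an algebraic group *)

Lemma strong_nullstellensatz (K : closedFieldType) n (J : set (mpoly n K)) f :
    ~ countable [set: K] ->
    (forall b, (forall p, J p -> meval b p = 0) -> meval b f = 0) ->
  exists m, ideal_gen J (f ^+ m).
Proof.
move=> uncK fJ; apply: contrapT => /forallNP noJ.
have [||_ _ [i _ <-] [j _ <-]|_ [m _ <-]|b [bJ bf]] :=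
    @countable_nullstellensatz K n uncK J (range (fun m => f ^+ m)).
- exact/(sub_countable (card_image_le _ _))/countableP.
- by exists 0%N; rewrite // expr0.
- by exists (i + j)%N; rewrite // exprD.
- exact: noJ.
by apply: (bf f); [exists 1%N; rewrite // expr1|exact: fJ].
Qed.

Section LieAlgebra.
Variables (K : numClosedFieldType) (n : nat).
Implicit Types (G : set (zmatrix K n)) (A X Y g z : 'M[K]_n).
Implicit Types p q : mpoly (n * n) K.

Definition vanishing G : set (mpoly (n * n) K) :=
  [set p | forall A, G A -> mxeval A p = 0].

Definition lie G : set 'M[K]_n :=
  [set X | forall p, vanishing G p -> mxdiff p 1%:M X = 0].

Lemma lieD G X Y : lie G X -> lie G Y -> lie G (X + Y).
Proof. by move=> lX lY p pG; rewrite mxdiffD lX // lY // addr0. Qed.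

Lemma lieZ G c X : lie G X -> lie G (c *: X).
Proof. by move=> lX p pG; rewrite mxdiffZ lX // mulr0. Qed.

Lemma lieB G X Y : lie G X -> lie G Y -> lie G (X - Y).
Proof. by move=> lX lY; rewrite -scaleN1r; apply/lieD/lieZ. Qed.

Variable H : set (zmatrix K n).
Hypothesis algH : algebraic_group H.

Let subH : is_subgroup H. Proof. by case: algH. Qed.
Let HM g z : H g -> H z -> H (g *m z). Proof. by case: subH => _ _ + _; apply. Qed.
Let HV g : H g -> H (invmx g). Proof. by case: subH => _ _ _; apply. Qed.
Let HU g : H g -> g \in unitmx. Proof. by case: subH => + _ _ _; apply. Qed.

Lemma algebraic_groupP A : A \in unitmx ->
  (forall p, vanishing H p -> mxeval A p = 0) -> H A.
Proof.
move=> uA vA; have [_ [Z /zmatrix_closedE[S ZE] HE]] := algH.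
rewrite HE; split=> //; rewrite ZE => p Sp.
by apply: vA => B; rewrite HE ZE => -[_]; apply.
Qed.

Lemma lie_right_tangent z X : H z ->
  (forall p, vanishing H p -> mxdiff p z X = 0) -> lie H (X *m invmx z).
Proof.
move=> Hz tX p pH; rewrite -(mulmxV (HU Hz)).
have := mxdiff_pullback (mulmxr (invmx z)) p z X; rewrite /= => <-.
by apply: tX => A HA; rewrite mxeval_pullback /=; apply/pH/HM/HV.
Qed.

Lemma lie_left_tangent z X p : H z -> lie H X -> vanishing H p ->
  mxdiff p z (z *m X) = 0.
Proof.
move=> Hz lX pH; rewrite -[in mxdiff _ z](mulmx1 z).
rewrite -(mxdiff_pullback (mulmx z)); apply: lX => A HA.
by rewrite mxeval_pullback; apply/pH/HM.
Qed.

Lemma lie_conj g X : H g -> lie H X -> lie H (g *m X *m invmx g).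
Proof.
move=> Hg lX p pH; pose f := mulmxr (invmx g) \o mulmx g : 'M[K]_n -> 'M[K]_n.
have -> : 1%:M = f 1%:M by rewrite /f /= mulmx1 mulmxV // HU.
rewrite -[_ *m _]/(f X) -(mxdiff_pullback f); apply: lX => A HA.
by rewrite mxeval_pullback; apply/pH/HM/HV => //; apply: HM.
Qed.

(** The ideal J generated by the equations of H and those of the centralizer need not
    be radical, but in characteristic 0 this does not matter. If q vanishes on the
    centralizer, then a power f ^+ m of f = q * det is in J, where det takes care of
    the singular matrices in the closure of H. The left-invariant field of X preserves
    J, and m applications of it to f ^+ m give m! (df X)^m at the identity, which is
    therefore 0. *)
Lemma lie_centralizer y X q : ~ countable [set: K] ->
    lie H X -> X *m y = y *m X ->
    vanishing (centralizer H y) q -> mxdiff q 1%:M X = 0.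
Proof.
move=> uncK lX Xy vq; have [_ H1 _ _] := subH.
have commE := mxeval_commutator y; set comm := commutator_mx y in commE *.
pose J := vanishing H `|` [set p | exists i j, p = comm i j].
pose delta := left_invariant X.
have J1 p : ideal_gen J p -> mxeval 1%:M p = 0.
  elim=> [|a b c Jb _ IH]; first exact: mxeval0.
  rewrite mxevalD mxevalM IH addr0.
  case: Jb => [/(_ _ H1) ->|[i [j ->]]]; first by rewrite mulr0.
  by rewrite commE mul1mx mulmx1 subrr mxE mulr0.
have deltaD : {morph delta : p q / p + q} by apply: left_invariantD.
have deltaM p r : delta (p * r) = delta p * r + p * delta r.
  exact: left_invariantM.
have delta0 : delta 0 = 0 by apply: (addrI (delta 0)); rewrite -deltaD !addr0.
have deltaJ p : ideal_gen J p -> ideal_gen J (delta p).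
  elim=> [|a b c Jb Jc IH]; first by rewrite delta0; apply: ideal_gen0.
  rewrite deltaD deltaM; apply: ideal_genD => //; apply: ideal_genD.
    exact/ideal_genMl/ideal_gen_mem.
  apply: ideal_genMl; case: Jb => [bH|[i [j ->]]].
    apply: ideal_gen_mem; left => A HA.
    by rewrite mxeval_left_invariant lie_left_tangent.
  have -> : delta (comm i j) = \sum_k mpolyC _ (X k j) * comm i k.
    rewrite [LHS]left_invariant_commutator // mxE.
    by apply: eq_bigr => k _; rewrite [map_mx _ _ _ _]mxE mulrC.
  apply: ideal_gen_sum => k; apply/ideal_genMl/ideal_gen_mem.
  by right; exists i, k.
pose f := q * \det (generic_mx K n).
have [|m Jfm] := @strong_nullstellensatz _ _ J f uncK.
  move=> b bJ; pose A : 'M[K]_n := vec_mx (\row_k b k).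
  have bE p : meval b p = mxeval A p.
    by apply: meval_eq => k; rewrite /A vec_mxK mxE.
  rewrite bE /f mxevalM mxeval_det.
  have [uA|] := boolP (A \in unitmx); last first.
    by rewrite unitmxE unitfE negbK => /eqP ->; rewrite mulr0.
  rewrite vq ?mul0r //; split.
    by apply: algebraic_groupP => // p pH; rewrite -bE; apply: bJ; left.
  apply/eqP; rewrite -subr_eq0; apply/eqP/matrixP => i j.
  by rewrite -commE -bE [RHS]mxE; apply: bJ; right; exists i, j.
have [r fm] := iter_derivation_exp deltaD deltaM f m.
have : ideal_gen J (iter m delta (f ^+ m)).
  have iterJ k u : ideal_gen J u -> ideal_gen J (iter k delta u).
    by move=> Ju; elim: k => //= k IH; apply: deltaJ.
  exact: iterJ.
have q1 : mxeval 1%:M q = 0 by apply: vq; split=> //; rewrite mul1mx mulmx1.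
have f1 : mxeval 1%:M f = 0 by rewrite /f mxevalM q1 mul0r.
move=> /J1/eqP; rewrite fm mxevalD mxevalM mxevalMn mxevalX f1 mul0r addr0.
rewrite mulrn_eq0 eqn0Ngt fact_gt0 /= expf_eq0 => /andP[_ /eqP].
rewrite mxeval_left_invariant mul1mx mxdiffM q1 mul0r addr0.
by rewrite mxeval_det det1 mulr1.
Qed.

End LieAlgebra.

(** Conjugation by y is diagonalizable, so that the projection pi on its fixed points
    along the other eigenspaces is a polynomial in it, the composite of the factors
    (Ad y - mu) / (1 - mu) for the eigenvalues mu <> 1. Being a polynomial in Ad y, it
    preserves the subspaces that Ad y preserves. *)
Lemma commuting_projection (K : fieldType) n (y : 'M[K]_n) :
    y \in unitmx -> diagonalizable y ->
  exists pi : 'M[K]_n -> 'M[K]_n, [/\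
    forall V : set 'M[K]_n, (forall u v, V u -> V v -> V (u - v)) ->
      (forall c u, V u -> V (c *: u)) ->
      (forall u, V u -> V (y *m u *m invmx y)) ->
      forall u, V u -> V (pi u),
    forall u, pi u *m y = y *m pi u,
    forall u, u *m y = y *m u -> pi u = u
  & forall u x, x *m y = y *m x -> pi (u *m x - x *m u) = pi u *m x - x *m pi u].
Proof.
move=> uy [P uP /diagonalizable_forPex[d /(simmxPp (stablemx_unit _ uP)) Py]].
pose T mu (u : 'M[K]_n) := (1 - mu)^-1 *: (y *m u *m invmx y - mu *: u).
pose r i j := d 0 i / d 0 j.
(* The eigenvalues mu <> 1 of Ad y are quotients of eigenvalues of y. *)
pose s := [seq r z.1 z.2 | z <- enum {: 'I_n * 'I_n} & r z.1 z.2 != 1].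
have s1 mu : mu \in s -> mu != 1.
  by move=> /mapP[z]; rewrite mem_filter => /andP[+ _] ->.
have PVy : invmx P *m diag_mx d = y *m invmx P.
  by rewrite -[LHS](mulmxK uP) -(mulmxA _ (diag_mx d)) -Py mulKmx.
have d0 j : d 0 j != 0.
  have : \det (diag_mx d) != 0.
    have := congr1 determinant Py; rewrite !det_mulmx mulrC => /mulIf <-.
      by rewrite -unitfE -unitmxE.
    by rewrite -unitfE -unitmxE.
  by rewrite det_diag => /prodf_neq0; apply.
(* In the basis E of eigenvectors, Ad y multiplies the (i, j) entry by r i j. *)
pose E u := P *m u *m invmx P.
have EZ c u : E (c *: u) = c *: E u by rewrite /E -scalemxAr -scalemxAl.
have EB u v : E (u - v) = E u - E v by rewrite /E mulmxBr mulmxBl.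
have Ey u : E (y *m u *m invmx y) *m diag_mx d = diag_mx d *m E u.
  by rewrite /E -mulmxA PVy !mulmxA mulmxKV // Py.
have Ecomm u : E u *m diag_mx d = diag_mx d *m E u -> u *m y = y *m u.
  rewrite /E -mulmxA PVy !mulmxA -Py => /(congr1 (fun v => invmx P *m (v *m P))).
  by rewrite !mulmxKV // -!mulmxA !mulKmx.
clearbody E.
have {}Ey u i j : E (y *m u *m invmx y) i j = r i j * E u i j.
  have /matrixP/(_ i j) := Ey u; rewrite mul_mx_diag mul_diag_mx !mxE => Euij.
  by apply: (mulIf (d0 j)); rewrite Euij mulrAC /r divfK.
have ET mu u i j : E (T mu u) i j = (r i j - mu) / (1 - mu) * E u i j.
  by rewrite /T EZ EB EZ !mxE Ey; ring.
pose pi u := foldr T u s.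
exists pi; split.
- move=> V VB VZ Vy u Vu; rewrite /pi; elim: (s) => //= mu l IH.
  by apply: (VZ); apply: VB; [apply: Vy|apply: (VZ)].
- move=> u; have Epi i j : r i j != 1 -> E (pi u) i j = 0.
    move=> rij; have : r i j \in s.
      by apply/mapP; exists (i, j); rewrite // mem_filter rij mem_enum.
    rewrite /pi; elim: (s) => //= mu l IH; rewrite inE ET => /predU1P[->|/IH ->].
      by rewrite subrr !mul0r.
    by rewrite mulr0.
  apply: Ecomm.
  apply/matrixP => i j; rewrite mul_mx_diag mul_diag_mx !mxE.
    have [rij|/Epi ->] := eqVneq (r i j) 1; last by rewrite mulr0 mul0r.
  by rewrite mulrC -[d 0 i](divfK (d0 j)) -/(r i j) rij mul1r.
- move=> u uyu; rewrite /pi; elim: (s) s1 => //= mu l IH s1.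
  rewrite IH => [|nu nul]; last by apply: s1; rewrite inE nul orbT.
  rewrite /T -uyu mulmxK // -{1}[u]scale1r -scalerBl scalerA mulVf ?scale1r //.
  by rewrite subr_eq0 eq_sym s1 ?mem_head.
move=> u x xy; rewrite /pi; elim: (s) => //= mu l ->; rewrite /T.
have xyV : invmx y *m x = x *m invmx y.
  by rewrite -[x in LHS](mulmxK uy) xy !mulmxA mulVmx // mul1mx.
move: (foldr _ _ _) => v; rewrite -scalemxAl -scalemxAr -scalerBr; congr (_ *: _).
rewrite mulmxBl mulmxBr !(mulmxBr, mulmxBl) scalerBr -scalemxAl -scalemxAr.
have -> : y *m (v *m x) *m invmx y = y *m v *m invmx y *m x.
  by rewrite -[RHS]mulmxA xyV !mulmxA.
have -> : y *m (x *m v) *m invmx y = x *m (y *m v *m invmx y).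
  by rewrite !mulmxA xy.
by rewrite !opprB addrACA [RHS]addrACA; congr (_ + _); rewrite addrC.
Qed.

(** * Orbits in the transporter *)

(** The orbits of the whole centralizers. Inverting the element of the centralizer of x
    would not change the orbit, and without it the action is polynomial. *)
Definition full_orbit (K : fieldType) n (H : set (zmatrix K n)) (x y z : zmatrix K n) :
    set (zmatrix K n) :=
  [set w | exists g h, [/\ centralizer H y g, centralizer H x h & w = g *m z *m h]].

Section Transporter.
Variables (K : numClosedFieldType) (n : nat).
Hypothesis uncountableK : ~ countable [set: K].
Variables (H : set (zmatrix K n)) (x y : 'M[K]_n).
Hypothesis algH : algebraic_group H.
Hypotheses (Hy : H y) (ssy : semisimple y).

Local Notation A := (commuting_transporter H x y).
Local Notation Zx := (centralizer H x).
Local Notation Zy := (centralizer H y).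

Let subH : is_subgroup H. Proof. by case: algH. Qed.
Let HM (g z : 'M[K]_n) : H g -> H z -> H (g *m z).
Proof. by case: subH => _ _ + _; apply. Qed.
Let HV (g : 'M[K]_n) : H g -> H (invmx g). Proof. by case: subH => _ _ _; apply. Qed.
Let HU (g : 'M[K]_n) : H g -> g \in unitmx. Proof. by case: subH => + _ _ _; apply. Qed.

(** Put x' = z x z^-1 and w = Dz z^-1. Since x' commutes with y, so does its derivative,
    which is [w, x']. Hence the part of w in the nontrivial eigenspaces of Ad y has a
    bracket with x' that is both fixed by Ad y and in these eigenspaces, so that this
    part commutes with x', while the rest of w commutes with y. *)
Lemma transporter_tangent (D : K -> K) (z : 'M[K]_n) : derivation D ->
    map_mx D x = 0 -> map_mx D y = 0 -> lie H (map_mx D z *m invmx z) -> A z ->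
  exists w u : 'M[K]_n, [/\ lie H w, w *m y = y *m w, lie H u, u *m x = x *m u
    & map_mx D z = w *m z + z *m u].
Proof.
move=> dD Dx Dy lDz [Hz zxy]; have uz := HU Hz; have uy := HU Hy.
set x' := z *m x *m invmx z in zxy *; set w := map_mx D z *m invmx z in lDz.
have x'z : x' *m z = z *m x by rewrite mulmxKV.
have zVx' : invmx z *m x' = x *m invmx z by rewrite /x' -!mulmxA mulKmx.
clearbody x'.
have wz : w *m z = map_mx D z by rewrite mulmxKV.
have Dx' : map_mx D x' = w *m x' - x' *m w.
  have DxE : map_mx D x' *m z + x' *m map_mx D z = map_mx D z *m x.
    by rewrite -map_derivationM // x'z map_derivationM // Dx mulmx0 addr0.
  apply: (can_inj (mulmxK uz)); rewrite mulmxBl -(mulmxA w) x'z mulmxA wz.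
  by rewrite -(mulmxA x') wz -DxE addrK.
have wx'y : (w *m x' - x' *m w) *m y = y *m (w *m x' - x' *m w).
  have := congr1 (map_mx D) zxy; rewrite !map_derivationM // Dy mulmx0 addr0.
  by rewrite mul0mx add0r Dx'.
have [pi [piV piy piK piB]] := commuting_projection uy ssy.
have lpi : lie H (pi w).
  apply: piV lDz => [u v|c u|u]; [exact: lieB|exact: lieZ|exact: lie_conj].
pose w1 := w - pi w.
have w1x' : w1 *m x' = x' *m w1.
  have pi_comm : pi w *m x' - x' *m pi w = w *m x' - x' *m w.
    by rewrite -piB // piK.
  have sub4 (a b c d : 'M[K]_n) : a - b - (c - d) = a - c - (b - d).
    by rewrite !opprB addrACA [RHS]addrACA (addrC (- b)).
  apply/eqP; rewrite -subr_eq0 /w1 mulmxBl mulmxBr sub4 pi_comm.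
  by rewrite subrr.
exists (pi w), (invmx z *m w1 *m z); split=> //.
- by have := lie_conj algH (HV Hz) (lieB lDz lpi); rewrite invmxK.
- rewrite -(mulmxA _ z) -x'z mulmxA -(mulmxA _ w1) w1x' (mulmxA _ x') zVx'.
  by rewrite !mulmxA.
- by rewrite !mulmxA mulmxV // mul1mx -mulmxDl addrC subrK.
Qed.

Local Notation O := (full_orbit H x y).

Let subZy : is_subgroup Zy := centralizer_subgroup y subH.
Let subZx : is_subgroup Zx := centralizer_subgroup x subH.
Let Zy1 : Zy 1%:M. Proof. by case: subZy. Qed.
Let Zx1 : Zx 1%:M. Proof. by case: subZx. Qed.

Lemma full_orbit_refl z : O z z.
Proof. by exists 1%:M, 1%:M; rewrite mulmx1 mul1mx. Qed.

Lemma full_orbit_move z w g h : Zy g -> Zx h -> O z w -> O z (g *m w *m h).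
Proof.
move=> Zg Zh [g' [h' [Zg' Zh' ->]]]; exists (g *m g'), (h' *m h).
have [_ _ ZyM _] := subZy; have [_ _ ZxM _] := subZx.
by split; [exact: ZyM|exact: ZxM|rewrite !mulmxA].
Qed.

Lemma full_orbit_sym z w : O z w -> O w z.
Proof.
move=> [g [h [Zg Zh ->]]]; exists (invmx g), (invmx h).
have [ZyU _ _ ZyV] := subZy; have [ZxU _ _ ZxV] := subZx.
split; [exact: ZyV|exact: ZxV|].
by rewrite !mulmxA mulVmx ?ZyU // mul1mx mulmxK // ZxU.
Qed.

Lemma full_orbit_trans z w v : O z w -> O w v -> O z v.
Proof. by move=> zw [g [h [Zg Zh ->]]]; apply: full_orbit_move. Qed.

Lemma full_orbit_eq z w : O z w -> O w = O z.
Proof.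
move=> zw; apply/seteqP; split=> v; apply: full_orbit_trans => //.
exact: full_orbit_sym.
Qed.

Lemma full_orbit_transporter z w : A z -> O z w -> A w.
Proof.
move=> [Hz zxy] [g [h [[Hg gy] [Hh hx] wE]]].
have uz := HU Hz; have ug := HU Hg; have uh := HU Hh.
have Hw : H w by rewrite wE; apply: HM => //; apply: HM.
have uw := HU Hw; split=> //.
have wx : w *m x = g *m (z *m x *m invmx z) *m invmx g *m w.
  by rewrite wE !mulmxA !mulmxKV // -!mulmxA hx.
rewrite wx mulmxK //; set x' := z *m x *m invmx z in zxy *.
have gVy : invmx g *m y = y *m invmx g.
  by rewrite -[y in LHS](mulmxK ug) -gy !mulmxA mulVmx // mul1mx.
by rewrite -(mulmxA _ _ y) gVy (mulmxA _ y) -(mulmxA g x' y) zxy (mulmxA g y) gy !mulmxA.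
Qed.

(** At a point w of the orbit, deriving p w = 0 gives the value at w of the derived
    polynomial plus the differential of p along Dw. The latter is 0 because Dw is
    tangent to the orbit. *)
Lemma full_orbit_vanishing_stable (D : K -> K) z p : derivation D ->
    map_mx D x = 0 -> map_mx D y = 0 ->
    (forall w, H w -> lie H (map_mx D w *m invmx w)) -> A z ->
  vanishing (O z) p -> vanishing (O z) (coef_derivation D p).
Proof.
move=> dD Dx Dy DH Az vp w Ow; have Aw := full_orbit_transporter Az Ow.
have [a [b [la ay lb bx Dw]]] := transporter_tangent dD Dx Dy (DH _ Aw.1) Aw.
have := derivation_mxeval w p dD; rewrite vp // derivation0 // Dw mxdiffD.
have -> : mxdiff p w (a *m w) = 0.
  have := mxdiff_pullback (mulmxr w) p 1%:M a; rewrite /= mul1mx => <-.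
  apply: (lie_centralizer algH uncountableK la ay) => g Zg.
  by rewrite mxeval_pullback /= -[_ *m w]mulmx1; apply/vp/full_orbit_move.
have -> : mxdiff p w (w *m b) = 0.
  have := mxdiff_pullback (mulmx w) p 1%:M b; rewrite /= mulmx1 => <-.
  apply: (lie_centralizer algH uncountableK lb bx) => g Zg.
  by rewrite mxeval_pullback /= -[w]mul1mx; apply/vp/full_orbit_move.
by rewrite !addr0.
Qed.

End Transporter.

(** * Finiteness for the whole centralizers *)

Lemma zeros_vanishing (K : numClosedFieldType) n (S : set (mpoly (n * n) K)) :
  zeros (vanishing (zeros S)) = zeros S.
Proof.
apply/seteqP; split=> A; first by move=> zA p Sp; apply: zA => B; apply.
by move=> zA p; apply.
Qed.

Lemma zeros_setI (K : fieldType) n (S T : set (mpoly (n * n) K)) :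
  zeros S `&` zeros T = zeros (S `|` T).
Proof.
apply/seteqP; split=> A; first by move=> [zS zT] p [/zS|/zT].
by move=> zA; split=> p ?; apply: zA; [left|right].
Qed.

(** A descending chain of closed sets is stationary, by the basis theorem. *)
Theorem noetherian_ind (K : numClosedFieldType) n (P : set 'M[K]_n -> Prop) :
    (forall S, (forall T, zeros T `<=` zeros S -> zeros T <> zeros S ->
       P (zeros T)) -> P (zeros S)) ->
  forall S, P (zeros S).
Proof.
move=> Pind S0; apply: contrapT => nP0.
have /choice[f fP] S : exists T, ~ P (zeros S) ->
    [/\ zeros T `<=` zeros S, zeros T <> zeros S & ~ P (zeros T)].
  have [PS|nPS] := pselect (P (zeros S)); first by exists S.
  apply: contrapT => /forallNP noT; apply: nPS; apply: Pind => T TS TnS.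
  by apply: contrapT => nPT; apply: (noT T).
pose s i := iter i f S0.
have nP i : ~ P (zeros (s i)) by elim: i => [//|i IH]; have [] := fP _ IH.
have s_dec i j : (i <= j)%N -> zeros (s j) `<=` zeros (s i).
  move=> /subnK <-; elim: (j - i)%N => [//|k IH] A.
  by have [sub _ _] := fP _ (nP (k + i)%N) => /sub/IH.
pose V := \bigcup_i vanishing (zeros (s i)).
have [t [tV Vt]] := hilbert_basis V.
have [k tk] : exists k, [set` t] `<=` vanishing (zeros (s k)).
  elim: t tV {Vt} => [|p t IH] tV; first by exists 0%N.
  have [|k tk] := IH; first by move=> q qt; apply: tV; rewrite /= inE qt orbT.
  have [|i _ pi] := tV p; first by rewrite /= mem_head.
  exists (maxn i k) => q /=; rewrite inE => /predU1P[->|/tk vq] A sA.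
    by apply: pi; apply: s_dec sA; apply: leq_maxl.
  by apply: vq; apply: s_dec sA; apply: leq_maxr.
have [sub neq _] := fP _ (nP k); apply: neq; apply/seteqP; split=> // A sA.
rewrite -[f (s k)]/(s k.+1) -zeros_vanishing => p vp.
have : ideal_gen [set` t] p by apply: Vt; exists k.+1.
elim=> [|a b c bt _ IH]; first exact: mxeval0.
rewrite [LHS]mxevalD mxevalM [mxeval A c]IH addr0.
by rewrite (tk _ bt A sA) mulr0.
Qed.

Section Finiteness.
Variables (K : numClosedFieldType) (n : nat).
Hypothesis uncountableK : ~ countable [set: K].
Variables (H : set (zmatrix K n)) (x y : 'M[K]_n).
Hypothesis algH : algebraic_group H.
Hypotheses (Hy : H y) (ssy : semisimple y).

Local Notation A := (commuting_transporter H x y).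
Local Notation Zx := (centralizer H x).
Local Notation Zy := (centralizer H y).
Local Notation O := (full_orbit H x y).

Variable gens : seq (mpoly (n * n) K).
Hypothesis gensH : [set` gens] `<=` vanishing H.
Hypothesis Hgens : vanishing H `<=` ideal_gen [set` gens].

Lemma ideal_gens_eval (B : 'M[K]_n) p : (forall q, q \in gens -> mxeval B q = 0) ->
  ideal_gen [set` gens] p -> mxeval B p = 0.
Proof.
move=> gB; elim=> [|a b c bg _ IH]; first exact: mxeval0.
by rewrite mxevalD mxevalM IH addr0 (gB _ bg) mulr0.
Qed.

Lemma mem_group_gens (B : 'M[K]_n) :
  H B <-> B \in unitmx /\ forall q, q \in gens -> mxeval B q = 0.
Proof.
split=> [HB|[uB gB]].
  by split=> [|q /gensH]; [case: algH => -[+ _ _ _] _; apply|apply].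
by apply: (algebraic_groupP algH uB) => p /Hgens; apply: ideal_gens_eval.
Qed.

Lemma derivation_tangent (D : K -> K) (w : 'M[K]_n) : derivation D ->
    (forall q m, q \in gens -> D (mcoeff m q) = 0) -> H w ->
  lie H (map_mx D w *m invmx w).
Proof.
move=> dD Dg Hw; apply: lie_right_tangent => // p /Hgens.
have [_ gw] := (mem_group_gens w).1 Hw.
elim=> [|a b c bg cg IH].
  rewrite /mxdiff big1 // => k _; by rewrite raddf0 mxeval0 mul0r.
have mxdiffDl u v : mxdiff (u + v) w (map_mx D w) =
    mxdiff u w (map_mx D w) + mxdiff v w (map_mx D w).
  rewrite /mxdiff -big_split /=; apply: eq_bigr => k _.
  by rewrite mderivD mxevalD mulrDl.
rewrite mxdiffDl IH addr0 mxdiffM gw // mulr0 add0r.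
have := derivation_mxeval w b dD; rewrite gw // derivation0 //.
have -> : coef_derivation D b = 0.
  by apply/mpolyP => m; rewrite mcoeff_coef_derivation // mcoeff0 Dg.
by rewrite mxeval0 add0r => <-; rewrite mulr0.
Qed.

Let M := (n * n + n * n)%N.
Let point (g h : 'M[K]_n) : 'I_M -> K := fun k => row_mx (mxvec g) (mxvec h) 0 k.
Let injl (p : mpoly (n * n) K) : mpoly M K :=
  comp_mpoly [tuple mpolyX K (mnm1 (lshift (n * n) k)) | k < n * n] p.
Let injr (p : mpoly (n * n) K) : mpoly M K :=
  comp_mpoly [tuple mpolyX K (mnm1 (rshift (n * n) k)) | k < n * n] p.

Let meval_injl g h p : meval (point g h) (injl p) = mxeval g p.
Proof.
rewrite comp_mpoly_meval; apply: meval_eq => k.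
by rewrite tnth_mktuple mevalXU /point row_mxEl.
Qed.

Let meval_injr g h p : meval (point g h) (injr p) = mxeval h p.
Proof.
rewrite comp_mpoly_meval; apply: meval_eq => k.
by rewrite tnth_mktuple mevalXU /point row_mxEr.
Qed.

Let point_surj (u : 'I_M -> K) : exists g h, u =1 point g h.
Proof.
exists (vec_mx (\row_k u (lshift _ k))), (vec_mx (\row_k u (rshift _ k))) => k.
rewrite /point !vec_mxK; case: (split_ordP k) => j ->.
  by rewrite row_mxEl mxE.
by rewrite row_mxEr mxE.
Qed.

Lemma full_orbit_constructible (z : 'M[K]_n) (X : set 'M[K]_n) : X !=set0 ->
  exists h, (exists2 w, X w & mxeval w h != 0) /\ exists b : bool,
    forall w, X w -> mxeval w h != 0 -> O z w <-> b.
Proof.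
move=> [w0 Xw0].
pose ij := enum {: 'I_n * 'I_n}.
pose eqs := [seq injl p | p <- gens] ++ [seq injr p | p <- gens] ++
  [seq injl (commutator_mx y k.1 k.2) | k <- ij] ++
  [seq injr (commutator_mx x k.1 k.2) | k <- ij].
pose q := injl (\det (generic_mx K n)) * injr (\det (generic_mx K n)).
pose F : 'M[mpoly M K]_n := map_mx injl (generic_mx K n)
  *m map_mx (@mpolyC M K) z *m map_mx injr (generic_mx K n).
pose phi (k : 'I_(n * n)) := mxvec F 0 k.
have phiE g h k : meval (point g h) (phi k) = mxvec (g *m z *m h) 0 k.
  transitivity (map_mx (meval (point g h)) (mxvec F) 0 k); first by rewrite mxE.
  have gE : map_mx (meval (point g h)) (map_mx injl (generic_mx K n)) = g.
    by apply/matrixP => i j; rewrite [LHS]mxE [map_mx injl _ _ _]mxE meval_injl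
      mxeval_generic.
  have hE : map_mx (meval (point g h)) (map_mx injr (generic_mx K n)) = h.
    by apply/matrixP => i j; rewrite [LHS]mxE [map_mx injr _ _ _]mxE meval_injr
      mxeval_generic.
  have zE : map_mx (meval (point g h)) (map_mx (@mpolyC M K) z) = z.
    by apply/matrixP => i j; rewrite !mxE mevalC.
  by rewrite map_mxvec !map_mxM gE hE zE.
pose X' : set ('I_(n * n) -> K) := [set v | X (vec_mx (\row_k v k))].
have X'E w : X w -> X' (mxvec w 0).
  move=> Xw; rewrite /X' /=; set w' := vec_mx _.
  by have -> : w' = w by rewrite -[RHS]mxvecK; congr vec_mx; apply/rowP => k; rewrite mxE.
have [|h [[v Xv vh] [b hb]]] := @constructible_image K (n * n) M eqs q phi X'.
  by exists (mxvec w0 0); apply: X'E.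
exists h; split.
  exists (vec_mx (\row_k v k)) => //; rewrite /mxeval; move: vh.
  by congr (_ != 0); apply: meval_eq => k; rewrite vec_mxK mxE.
exists b => w Xw wh; rewrite -(hb _ (X'E _ Xw) wh).
have eqsP g h' : (forall p, p \in eqs -> meval (point g h') p = 0) /\
    meval (point g h') q != 0 <-> Zy g /\ Zx h'.
  have qE : meval (point g h') q = \det g * \det h'.
    by rewrite mevalM meval_injl meval_injr !mxeval_det.
  rewrite qE mulf_eq0 negb_or -!unitfE -!unitmxE.
  split=> [[eqs0 /andP[ug uh]]|[[Hg gy] [Hh hx]]].
    have comm0 a c : (forall i j, mxeval a (commutator_mx c i j) = 0) ->
        a *m c = c *m a.
      move=> ac; apply/eqP; rewrite -subr_eq0; apply/eqP/matrixP => i j.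
      by rewrite -mxeval_commutator ac mxE.
    split; split.
    - apply/mem_group_gens; split=> // p pg; rewrite -(meval_injl g h'); apply: eqs0.
      by rewrite mem_cat map_f.
    - apply: comm0 => i j; rewrite -(meval_injl g h'); apply: eqs0.
      rewrite !mem_cat; apply/or4P/Or43.
      by apply/mapP; exists (i, j); rewrite ?mem_enum.
    - apply/mem_group_gens; split=> // p pg; rewrite -(meval_injr g h'); apply: eqs0.
      by rewrite !mem_cat (map_f _ pg) orbT.
    - apply: comm0 => i j; rewrite -(meval_injr g h'); apply: eqs0.
      rewrite !mem_cat; apply/or4P/Or44.
      by apply/mapP; exists (i, j); rewrite ?mem_enum.
  have [ug g0] := (mem_group_gens g).1 Hg; have [uh h0] := (mem_group_gens h').1 Hh.
  rewrite ug uh; split=> // p; rewrite !mem_cat => /or4P[] /mapP[k kP ->].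
  - by rewrite meval_injl g0.
  - by rewrite meval_injr h0.
  - by rewrite meval_injl mxeval_commutator gy subrr mxE.
  - by rewrite meval_injr mxeval_commutator hx subrr mxE.
split=> [[g [h' [Zg Zh wE]]]|[u [u_eqs uq uphi]]].
  exists (point g h'); have [H1 H2] := (eqsP g h').2 (conj Zg Zh).
  by split=> // k; rewrite phiE -wE.
have [g [h' uE]] := point_surj u; exists g, h'.
have [|Zg Zh] := (eqsP g h').1.
  split=> [p /u_eqs <-|]; first by apply: meval_eq => k; rewrite uE.
  by move: uq; congr (_ != 0); apply: meval_eq => k; rewrite uE.
split=> //; apply: (can_inj mxvecK); apply/rowP => k.
by rewrite -phiE -uphi; apply: meval_eq => l; rewrite uE.
Qed.

(** The orbit is the image of a quasi-affine set under a polynomial map, so it contains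
    a nonempty open subset of its closure, and a translate of this one contains z. *)
Lemma full_orbit_locally_closed (z : 'M[K]_n) :
  exists h, mxeval z h != 0 /\
    forall w, zeros (vanishing (O z)) w -> mxeval w h != 0 -> O z w.
Proof.
pose X := zeros (vanishing (O z)).
have OX w : O z w -> X w by move=> Ow p; apply.
have Oz : O z z := full_orbit_refl x y algH z.
have [|h [[v Xv vh] [b hb]]] := full_orbit_constructible z (X := X).
  by exists z; apply: OX.
have [w [Ow wh]] : exists w, O z w /\ mxeval w h != 0.
  apply: contrapT => /forallNP noO; move/eqP: vh; apply; apply: Xv => w Ow.
  by apply: contrapT => /eqP wh; apply: (noO w).
have b1 : b by apply/(hb w (OX _ Ow) wh).
have [g [g' [Zg Zg' wE]]] := Ow.
pose f := mulmxr g' \o mulmx g : 'M[K]_n -> 'M[K]_n.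
exists (pullback f h); rewrite mxeval_pullback /= -wE; split=> // u Xu.
rewrite mxeval_pullback => fuh; have Xfu : X (f u).
  move=> p vp; rewrite -[LHS](mxeval_pullback f); apply: Xu => t Ot.
  by rewrite mxeval_pullback; apply: vp; apply: (full_orbit_move algH).
have Ofu : O z (f u) by apply/(hb _ Xfu fuh).
apply: (full_orbit_trans algH Ofu).
by apply: (full_orbit_sym algH); exists g, g'.
Qed.

(** Inside GL_n the transporter is closed: the inverse is the adjugate up to a
    nonzero scalar. *)
Lemma transporter_closed : exists T, forall z : 'M[K]_n, z \in unitmx ->
  A z <-> zeros T z.
Proof.
pose GX := generic_mx K n; pose C B := map_mx (@mpolyC (n * n) K) B : 'M_n.
pose c : 'M_n := GX *m C x *m \adj GX *m C y - C y *m (GX *m C x *m \adj GX).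
have cE z i j : mxeval z (c i j) =
    (z *m x *m \adj z *m y - y *m (z *m x *m \adj z)) i j.
  have <- : map_mx (meval (mxvec z 0)) c =
      z *m x *m \adj z *m y - y *m (z *m x *m \adj z).
    by rewrite map_mxB !map_mxM map_mx_adj map_generic_mx !map_mpolyC_mx.
  by rewrite [RHS]mxE.
exists (vanishing H `|` [set p | exists i j, p = c i j]) => z uz.
have d0 : \det z != 0 by rewrite -unitfE -unitmxE.
have adjE : \adj z = \det z *: invmx z.
  by rewrite /invmx uz scalerA mulfV // scale1r.
have commE : z *m x *m \adj z *m y - y *m (z *m x *m \adj z) =
    \det z *: (z *m x *m invmx z *m y - y *m (z *m x *m invmx z)).
  by rewrite adjE -!scalemxAr -!scalemxAl scalerBr.
split=> [[Hz zxy] p [|[i [j ->]]]|zT].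
- exact.
- by rewrite -/(mxeval z _) cE commE zxy subrr scaler0 mxE.
split; first by apply: (algebraic_groupP algH uz) => p vp; apply: zT; left.
apply/eqP; rewrite -subr_eq0; apply/eqP; apply: (scalerI d0).
rewrite -commE scaler0; apply/matrixP => i j.
by rewrite -cE [RHS]mxE; apply: zT; right; exists i, j.
Qed.

Let orbits_in (B : set 'M[K]_n) := [set O z | z in A `&` B].

(** By noetherian induction on a closed set B, the transporter has finitely many orbits
    that meet B. Suppose that this holds for the closed proper subsets of B but fails
    for B. Then the vanishing ideal of B is prime, and it is also that of the part of B
    in the transporter. Let z be a point of B that is generic over the countable field
    of constants of the derivations that kill the coefficients of all the equations at
    hand: the polynomials with constant coefficients that vanish at z vanish on B. The
    polynomials that vanish on the orbit of z are spanned by ones with constant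
    coefficients, so they vanish on B: the orbit of z is dense in B. As it is open in
    its closure, its complement in B is contained in a closed proper subset. *)
Theorem finite_full_orbits : finite_set [set O z | z in A].
Proof.
have zeros0 : zeros set0 = [set: 'M[K]_n] by apply/seteqP; split=> // ? _ ?.
have <- : orbits_in (zeros set0) = [set O z | z in A].
  by rewrite /orbits_in zeros0 setIT.
apply: (noetherian_ind (P := fun B => finite_set (orbits_in B))) => S IH.
set B := zeros S.
have sub_fin T : zeros T `<=` B -> (exists2 w, B w & ~ zeros T w) ->
    finite_set (orbits_in (zeros T)).
  by move=> TB [w Bw Tw]; apply: IH => // TE; apply: Tw; rewrite TE.
apply: contrapT => infB.
(* Otherwise the zeros of p in B are a smaller closed set that meets the same orbits. *)
have dense p : (forall w, A w -> B w -> mxeval w p = 0) -> vanishing B p.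
  move=> pAB; apply: contrapT => /existsNP[w /not_implyP[Bw pw]]; apply: infB.
  rewrite (_ : orbits_in B = orbits_in (B `&` zeros [set p])).
    rewrite zeros_setI; apply: sub_fin; rewrite -zeros_setI; first by move=> v [].
    by exists w => // -[_ /(_ p erefl)].
  rewrite /orbits_in; congr image; apply/seteqP; split=> v [Av]; last by case.
  by move=> Bv; split=> //; split=> // _ ->; apply: pAB.
have [w0 [Aw0 Bw0]] : exists w, A w /\ B w.
  apply: contrapT => noAB; apply: infB; rewrite (_ : orbits_in B = set0) //.
  by apply/seteqP; split=> // t [w [Aw Bw] _]; case: noAB; exists w.
have prime p q : vanishing B (p * q) -> vanishing B p \/ vanishing B q.
  move=> vpq; apply: contrapT => /not_orP[/existsNP[u /not_implyP[Bu pu]]].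
  move=> /existsNP[v /not_implyP[Bv qv]]; apply: infB.
  rewrite (_ : orbits_in B = orbits_in (B `&` zeros [set p]) `|`
      orbits_in (B `&` zeros [set q])).
    rewrite finite_setU !zeros_setI; split; apply: sub_fin; rewrite -zeros_setI;
      try by move=> ? [].
      by exists u => // -[_ /(_ p erefl)].
    by exists v => // -[_ /(_ q erefl)].
  apply/seteqP; split=> [_ [w [Aw Bw] <-]|_ [|] [w [Aw [Bw _]] <-]]; last 2 first.
  - by exists w.
  - by exists w.
  have := vpq w Bw; rewrite mxevalM => /eqP; rewrite mulf_eq0 => /orP[] /eqP wpq.
    by left; exists w => //; split=> //; split=> // _ ->.
  by right; exists w => //; split=> //; split=> // _ ->.
(* The determinant is among the equations so that the generic point is invertible. *)
pose dt := \det (generic_mx K n).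
pose e (k : ('I_n * 'I_n) + ('I_n * 'I_n) + (nat * multinom (n * n))) : K :=
  match k with
  | inl (inl ij) => x ij.1 ij.2
  | inl (inr ij) => y ij.1 ij.2
  | inr im => mcoeff im.2 (nth 0 (dt :: gens) im.1)
  end.
pose E := range e.
have countableE : countable E.
  exact/(sub_countable (card_image_le _ _))/countableP.
have cdt : constant_coefs E dt.
  by move=> m; apply: constants_sub; exists (inr (0%N, m)).
have dtB : ~ vanishing B dt.
  have [_ _] := algH.1; have [HU _ _ _] := algH.1.
  move=> _ _ /(_ w0 Bw0)/eqP; rewrite mxeval_det; apply/negP.
  by rewrite -unitfE -unitmxE; apply: HU; case: Aw0.
have [||p q [cp vp] [cq vq]|p [cp vp]|b [bB bS]] := @countable_nullstellensatz K
    (n * n) uncountableK (vanishing B) (constant_coefs E `&` ~` vanishing B).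
- apply: (@sub_countable _ _ _ (constant_coefs E)).
    by apply: subset_card_le => p [].
  exact: countable_constant_coefs.
- split; first exact: constant_coefs1.
  by move=> /(_ w0 Bw0)/eqP; rewrite /mxeval meval1 oner_eq0.
- by split; [exact: constant_coefsM|move=> /prime[]].
- move=> Ip; apply: vp => w Bw; elim: Ip => [|q a r vq _ IHr]; first exact: mxeval0.
  by rewrite mxevalD mxevalM IHr vq // mulr0 addr0.
pose z : 'M[K]_n := vec_mx (\row_k b k).
have bE p : meval b p = mxeval z p.
  by apply: meval_eq => k; rewrite /z vec_mxK mxE.
have Bz : B z.
  by rewrite /B -zeros_vanishing => p vp; rewrite -/(mxeval z p) -bE; apply: bB.
have uz : z \in unitmx.
  by rewrite unitmxE unitfE -mxeval_det -bE; apply/eqP/bS; split.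
have Az : A z.
  have [T TP] := transporter_closed; apply/(TP z uz) => p Tp.
  rewrite -/(mxeval z p) -bE; apply: bB; apply: dense => w Aw Bw.
  have uw : w \in unitmx by have [HU _ _ _] := algH.1; apply: HU; case: Aw.
  exact: (TP w uw).1.
have generic_z p : constant_coefs E p -> mxeval z p = 0 -> vanishing B p.
  by move=> cp zp; apply: contrapT => vp; apply: (bS p); rewrite // bE.
have BO : B `<=` zeros (vanishing (O z)).
  suff OB : vanishing (O z) `<=` vanishing B by move=> w Bw p /OB; apply.
  have vD (G : set 'M[K]_n) p q : vanishing G p -> vanishing G q -> vanishing G (p + q).
    by move=> vp vq w Gw; rewrite mxevalD vp // vq // addr0.
  have vZ (G : set 'M[K]_n) c p : vanishing G p -> vanishing G (c *: p).
    by move=> vp w Gw; rewrite -mul_mpolyC mxevalM vp // mulr0.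
  apply: (@derivation_stable_ind K (n * n) E); [exact: vD|exact: vZ| |
    by move=> w _; exact: mxeval0|exact: vD|exact: vZ|].
    move=> D p dD DE.
    apply: (full_orbit_vanishing_stable uncountableK algH Hy ssy dD) => //.
    - by apply/matrixP => i j; rewrite !mxE; apply: DE; exists (inl (inl (i, j))).
    - by apply/matrixP => i j; rewrite !mxE; apply: DE; exists (inl (inr (i, j))).
    - move=> w; apply: derivation_tangent => // q m qg; apply: DE.
      by exists (inr ((index q gens).+1, m)); rewrite //= nth_index.
  move=> p [vp cp]; apply: generic_z => //; apply: vp.
  exact: full_orbit_refl x y algH z.
have [h [zh hO]] := full_orbit_locally_closed z.
apply: infB; apply: (@sub_finite_set _ _ ([set O z] `|` orbits_in (B `&` zeros [set h]))).
  move=> _ [w [Aw Bw] <-]; have [wh|wh] := eqVneq (mxeval w h) 0.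
    by right; exists w => //; split=> //; split=> // _ ->.
  by left; apply: (full_orbit_eq algH); apply: hO => //; apply: BO.
rewrite finite_setU; split; first exact: finite_set1.
rewrite zeros_setI; apply: sub_fin; rewrite -zeros_setI; first by move=> ? [].
by exists z => // -[_ /(_ h erefl)]; apply/eqP.
Qed.

End Finiteness.

(** * Identity components *)

Section IdentityComponent.
Variables (K : numClosedFieldType) (n : nat).
Implicit Types G : set (zmatrix K n).

(** The trace on G of a closed set that is minimal among those whose trace meets
    infinitely many cosets is connected, and therefore meets only one coset. *)
Theorem identity_component_finite_index G : is_subgroup G ->
  exists2 R : set 'M[K]_n, finite_set R & R `<=` G /\
    forall g, G g -> exists2 r, R r & identity_component G (invmx r *m g).
Proof.
move=> subG; have [GU G1 GM GV] := subG; set G0 := identity_component G.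
have [G0U G01 G0M G0V] := identity_component_subgroup subG.
pose coset (g : 'M[K]_n) : set 'M[K]_n := [set w | G0 (invmx g *m w)].
pose cosets (B : set 'M[K]_n) := [set coset g | g in G `&` B].
have coset_eq g h : G g -> G h -> G0 (invmx g *m h) -> coset h = coset g.
  move=> /GU ug /GU uh ghG0; apply/seteqP; split=> w wG0.
    rewrite /coset /= -[w](mulKVmx uh) (mulmxA (invmx g)).
    exact: (G0M _ _ ghG0 wG0).
  rewrite /coset /= -[w](mulKVmx ug) (mulmxA (invmx h)); apply: (G0M) wG0.
  have := G0V _ ghG0; congr G0.
  apply: (can_inj (mulKmx (_ : invmx g *m h \in unitmx))).
    by rewrite unitmx_mul unitmx_inv ug.
  by rewrite mulmxV ?unitmx_mul ?unitmx_inv ?ug // -mulmxA mulKVmx ?mulVmx.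
have fin_cosets : finite_set (cosets setT).
  rewrite (_ : setT = zeros set0); last by apply/seteqP; split=> // ? _ ?.
  apply: (noetherian_ind (P := fun B => finite_set (cosets B))) => S IH.
  set B := zeros S; apply: contrapT => infB.
  have [[g0 [Gg0 Bg0]]|noGB] := pselect (exists g, G g /\ B g); last first.
    apply: infB; rewrite (_ : cosets B = set0) //.
    by apply/seteqP; split=> // t [w [Gw Bw] _]; case: noGB; exists w.
  have GB_conn : connected (G `&` B : set (zmatrix K n)).
    move=> B1 B1n0 [C2 /zmatrix_openE[S2 C2E] B1C2] [C1 /zmatrix_closedE[S1 C1E] B1C1].
    have sub_fin T : B `&` zeros T <> B -> finite_set (cosets (B `&` zeros T)).
      by rewrite zeros_setI => TB; apply: IH => //; rewrite -zeros_setI; apply: subIsetl.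
    have [BS1|BS1] := pselect (B `&` zeros S1 = B).
      by rewrite B1C1 C1E -setIA BS1.
    have [BS2|BS2] := pselect (B `&` zeros S2 = B).
      case: B1n0 => w; rewrite B1C2 C2E => -[[_ Bw]] []; move: Bw.
      by rewrite -{1}BS2 => -[].
    case: infB; apply: (@sub_finite_set _ _ (cosets (B `&` zeros S1) `|`
      cosets (B `&` zeros S2))); last by rewrite finite_setU; split; apply: sub_fin.
    move=> _ [w [Gw Bw] <-]; have [wS1|wS1] := pselect (zeros S1 w).
      by left; exists w.
    right; exists w => //; split=> //; split=> //; apply: contrapT => wS2.
    have : B1 w by rewrite B1C2 C2E.
    by rewrite B1C1 C1E => -[].
  apply: infB; apply: (@sub_finite_set _ _ [set coset g0]); last exact: finite_set1.
  move=> _ [g [Gg Bg] <-]; apply: coset_eq => //.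
  pose T : set (zmatrix K n) := [set (invmx g0 *m w : zmatrix K n) | w in G `&` B].
  apply: (@connected_component_max _ G T); last by exists g.
  - by exists g0 => //; rewrite mulVmx // GU.
  - by move=> _ [w [Gw _] <-]; apply: GM => //; apply: GV.
  - apply: connected_continuous_connected => //.
    exact/continuous_subspaceT/continuous_mull.
have /choice[rep repP] t : exists g, cosets setT t -> G g /\ coset g = t.
  have [[g [Gg _] <-]|nt] := pselect (cosets setT t); first by exists g.
  by exists 1%:M.
exists (rep @` cosets setT); first exact: finite_image.
split=> [_ [t /repP[Gt _] <-]//|g Gg].
have tg : cosets setT (coset g) by exists g.
exists (rep (coset g)); first by exists (coset g).
have [_ cE] := repP _ tg; suff : coset (rep (coset g)) g by [].
by rewrite cE /coset /= mulVmx // GU.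
Qed.

End IdentityComponent.

Section Main.
Variables (K : numClosedFieldType) (n : nat).
Hypothesis uncountableK : ~ countable [set: K].

(** As the identity components have finite index in the centralizers, each orbit of the
    whole centralizers is a finite union of orbits of the identity components. *)
Theorem finite_transporter_orbits (H : set (zmatrix K n)) (x y : zmatrix K n) :
    algebraic_group H -> H y -> semisimple y ->
  finite_set [set transporter_orbit H x y z | z in commuting_transporter H x y].
Proof.
move=> algH Hy ssy; have subH := algH.1.
have subZx := centralizer_subgroup x subH; have subZy := centralizer_subgroup y subH.
have [_ _ Zx0M Zx0V] := identity_component_subgroup subZx.
have [_ _ Zy0M Zy0V] := identity_component_subgroup subZy.
have [gens [gensH Hgens]] := hilbert_basis (vanishing H).
pose A := commuting_transporter H x y.
have finO : finite_set [set full_orbit H x y z | z in A].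
  by apply: finite_full_orbits gensH Hgens.
have [R finR [RZ ZR]] := identity_component_finite_index subZx.
have [Q finQ [QZ ZQ]] := identity_component_finite_index subZy.
have /choice[rep repP] t : exists z, [set full_orbit H x y z | z in A] t ->
    full_orbit H x y z = t.
  have [[z _ <-]|nt] := pselect ([set full_orbit H x y z | z in A] t); first by exists z.
  by exists 1%:M.
have orbitP z w : transporter_orbit H x y z w <-> exists u v,
    [/\ identity_component (centralizer H y) u,
       identity_component (centralizer H x) v & w = u *m z *m v].
  split=> [[v [u [Zv Zu ->]]]|[u [v [Zu Zv ->]]]].
    by exists u, (invmx v); split=> //; exact: Zx0V.
  by exists (invmx v), u; split=> //; [exact: Zx0V|rewrite invmxK].
have orbit_eq z w : transporter_orbit H x y z w ->
    transporter_orbit H x y w = transporter_orbit H x y z.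
  move=> /orbitP[u [v [Zu Zv wE]]]; apply/seteqP; split=> t /orbitP[a [b [Za Zb ->]]].
    apply/orbitP; exists (a *m u), (v *m b); rewrite wE !mulmxA.
    by split=> //; [exact: Zy0M|exact: Zx0M].
  apply/orbitP; exists (a *m invmx u), (invmx v *m b); split.
  - by apply: Zy0M => //; exact: Zy0V.
  - by apply: Zx0M => //; exact: Zx0V.
  have uu : u \in unitmx by case: subZy => + _ _ _; apply; apply: identity_component_sub.
  have uv : v \in unitmx by case: subZx => + _ _ _; apply; apply: identity_component_sub.
  by rewrite wE !mulmxA mulmxKV // mulmxK.
pose F (t : set (zmatrix K n) * 'M[K]_n * 'M[K]_n) :=
  transporter_orbit H x y (invmx t.1.2 *m rep t.1.1 *m t.2).
apply: (@sub_finite_set _ _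
  (F @` (([set full_orbit H x y z | z in A] `*` Q) `*` R))); last first.
  by apply: finite_image; apply: finite_setX => //; apply: finite_setX.
move=> _ [w Aw <-].
have Fw : [set full_orbit H x y z | z in A] (full_orbit H x y w) by exists w.
have : full_orbit H x y (rep (full_orbit H x y w)) w.
  by rewrite (repP _ Fw); apply: full_orbit_refl x y algH w.
set z := rep _ => -[g [h [Zg Zh wE]]].
have [r Rr rh] := ZR h Zh.
have [q Qq qg] : exists2 q, Q q &
    identity_component (centralizer H y) (invmx q *m invmx g).
  by apply: ZQ; case: subZy => _ _ _; apply.
have ug : g \in unitmx by case: subZy => + _ _ _; apply.
have uq : q \in unitmx by case: subZy => + _ _ _; apply; apply: QZ.
have ur : r \in unitmx by case: subZx => + _ _ _; apply; apply: RZ.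
exists (full_orbit H x y w, q, r); first by [].
rewrite /F /= -/z; symmetry; apply: orbit_eq; apply/orbitP.
exists (g *m q), (invmx r *m h); split=> //.
  have := Zy0V _ qg; congr (identity_component _ _).
  apply: (can_inj (mulKmx (_ : invmx q *m invmx g \in unitmx))).
    by rewrite unitmx_mul !unitmx_inv uq.
  rewrite mulmxV ?unitmx_mul ?unitmx_inv ?uq //.
  by rewrite -mulmxA mulKmx // mulVmx.
by rewrite wE -!mulmxA !mulKVmx.
Qed.

End Main.

Lemma uncountable_complex (R : realType) : ~ countable [set: R[i]].
Proof.
move=> /countable_injP[f f_inj].
have : countable [set` `[0 : R, 1]].
  apply/countable_injP; exists (fun r => f r%:C%C) => r s _ _ rs.
  by have [] := f_inj _ _ (in_setT _) (in_setT _) rs.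
move=> /countable_lebesgue_measure0/eqP.
by rewrite lebesgue_measure_itv /= lte_fin ltr01 oppr0 adde0 eqe oner_eq0.
Qed.

Theorem lemma1p2 (R : realType) (n : nat) (H : set (zmatrix R[i] n))
    (x y : zmatrix R[i] n) :
  reductive H ->
  H x -> semisimple x ->
  H y -> semisimple y ->
  finite_set [set transporter_orbit H x y z | z in commuting_transporter H x y].
Proof.
move=> [algH _] _ _ Hy ssy.
exact: (finite_transporter_orbits (@uncountable_complex R) x algH Hy ssy).
Qed.
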